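(* For every $k,d\in\mathbb N$, $$\max\Bigl\{\|p^{(k)}\|_{\mathbb R_+}\ :\ \mathbf h\in\Delta_d,\ p\in\mathcal P_{\mathbf h},\ \|p\|_{\mathbb R_+}\le1\Bigr\}\ \le\ \sum_{j=0}^{k}\frac{8^j\binom{d-1}{j}\binom{k}{j}}{\binom{2j}{j}},$$ where terms with $j\ge d$ are zero. The maximum on the left equals $M_{k,d}$ and is attained at $p=S_d$, and the inequality is asymptotically tight: for fixed $k$, the ratio of the left-hand side to the right-hand side tends to $1$ as $d\to\infty$.
   Context: Let $\mathbb R_+=[0,\infty)$ and $\|f\|_{\mathbb R_+}=\sup_{t\ge 0}|f(t)|$. For a vector $\mathbf h=(h_1,\dots,h_d)$ with $0<h_1\le\cdots\le h_d$, let $\mathcal P_{\mathbf h}$ be the $d$-dimensional space of real functions on $\mathbb R_+$ spanned by the following system: each distinct value $\eta$ occurring exactly $m$ times among $h_1,\dots,h_d$ contributes the $m$ functions $e^{-\eta t}, te^{-\eta t},\dots,t^{m-1}e^{-\eta t}$. For $k\in\mathbb N$, $M_k(\mathbf h)=\max\{\|p^{(k)}\|_{\mathbb R_+}: p\in\mathcal P_{\mathbf h},\ \|p\|_{\mathbb R_+}\le 1\}$. Let $\Delta_d=\{\mathbf h\in\mathbb R^d: 0<h_1\le\cdots\le h_d\le 1\}$, $\mathbf e=(1,\dots,1)\in\mathbb R^d$, and $M_{k,d}=M_k(\mathbf e)$. The $\mathbf h$-Chebyshev polynomial $T_{\mathbf h}$ is the unique $T\in\mathcal P_{\mathbf h}$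 with $\|T\|_{\mathbb R_+}=1$ for which there exist points $0=\nu_1<\nu_2<\cdots<\nu_d$ with $T(\nu_j)=(-1)^j$ for $j=1,\dots,d$. Set $S_d=T_{\mathbf e}$. Binomial coefficients satisfy $\binom{n}{0}=1$ for $n\ge 0$. *)

(* Defs.v *)
From Stdlib Require Import Reals Lra List.
Import ListNotations.
Open Scope R_scope.

Definition sumR (n : nat) (f : nat -> R) : R :=
  fold_right Rplus 0 (map f (seq 0 n)).

Fixpoint binom (n k : nat) : nat :=
  match n, k with
  | _, O => 1%nat
  | O, S _ => 0%nat
  | S n', S k' => (binom n' k' + binom n' (S k'))%nat
  end.

(* A vector h = (h_1,...,h_d) is encoded as h : nat -> R, using indices 0..d-1. *)
Definition in_Delta (d : nat) (h : nat -> R) : Prop :=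
  0 < h 0%nat /\
  (forall i, (S i < d)%nat -> h i <= h (S i)) /\
  (forall i, (i < d)%nat -> h i <= 1).

Definition evec : nat -> R := fun _ => 1.

(* Number of earlier indices j < i with h_j = h_i. Since h is nondecreasing,
   equal values are consecutive, so index i contributes t^(mult h i) e^{-h_i t}:
   each value eta of multiplicity m contributes t^0,...,t^(m-1) times e^{-eta t}. *)
Definition mult (h : nat -> R) (i : nat) : nat :=
  length (filter (fun j => if Req_EM_T (h j) (h i) then true else false) (seq 0 i)).

Definition basis_fun (h : nat -> R) (i : nat) (t : R) : R :=
  t ^ (mult h i) * exp (- h i * t).

(* p belongs to the d-dimensional space P_h (as a function on R; we only
   evaluate it on R_+). *)
Definition in_P (d : nat) (h : nat -> R) (p : R -> R) : Prop :=
  exists c : nat -> R, forall t, p t = sumR d (fun i => c i * basis_fun h i t).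

Fixpoint nth_deriv (k : nat) (f g : R -> R) : Prop :=
  match k with
  | O => forall t, g t = f t
  | S k' => exists f' : R -> R,
      (forall t, derivable_pt_lim f t (f' t)) /\ nth_deriv k' f' g
  end.

Definition supnorm_le1 (f : R -> R) : Prop :=
  forall t, 0 <= t -> Rabs (f t) <= 1.

(* The set of values |f(t)|, t >= 0, whose lub is ||f||_{R_+}. *)
Definition abs_vals (f : R -> R) : R -> Prop :=
  fun x => exists t, 0 <= t /\ x = Rabs (f t).

(* The set {|p^(k)(t)| : h in Delta_d, p in P_h, ||p|| <= 1, t >= 0};
   its lub is max{ ||p^(k)|| : h in Delta_d, p in P_h, ||p|| <= 1 }. *)
Definition LHS_set (k d : nat) : R -> Prop :=
  fun x => exists h p g, in_Delta d h /\ in_P d h p /\ supnorm_le1 p /\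
    nth_deriv k p g /\ abs_vals g x.

(* The analogous set for h = e; its lub is M_{k,d}. *)
Definition M_set (k d : nat) : R -> Prop :=
  fun x => exists p g, in_P d evec p /\ supnorm_le1 p /\
    nth_deriv k p g /\ abs_vals g x.

(* T is the h-Chebyshev polynomial (1-based indices for nu as in the paper). *)
Definition is_cheb (d : nat) (h : nat -> R) (T : R -> R) : Prop :=
  in_P d h T /\ is_lub (abs_vals T) 1 /\
  exists nu : nat -> R,
    nu 1%nat = 0 /\
    (forall j, (1 <= j)%nat -> (j < d)%nat -> nu j < nu (S j)) /\
    (forall j, (1 <= j)%nat -> (j <= d)%nat -> T (nu j) = (-1) ^ j).

Definition RHS (k d : nat) : R :=
  sumR (S k) (fun j => 8 ^ j * INR (binom (d - 1) j) * INR (binom k j)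
                        / INR (binom (2 * j) j)).

(* Main.v *)
Require Import Defs.
From Stdlib Require Import Reals Lra Lia List Permutation Psatz Arith.
From Stdlib Require Import IndefiniteDescription Classical.
Import ListNotations.
Open Scope R_scope.

(* The spaces P_h are translation invariant, so |p^(k)(0)| has to be bounded. If p is in
   P_h and q in P_h', where h' arises from h by increasing one exponent, if |p| <= 1 at
   nodes 0 = nu_1 < ... < nu_d and q alternates there with |q(nu_j)| >= 1, then
   |p^(k)(0)| <= |q^(k)(0)|: otherwise some q - c p with |c| < 1 would have a k-th
   derivative with too many sign changes, counted with Rolle's theorem for the operators
   D + a. Raising the exponents one at a time to 1, and interpolating at the nodes of S_d in
   the intermediate spaces, leads from P_h to S_d. The existence of S_d follows from
   compactness and a Remez exchange.
   For the upper bound, q is H_2n(sqrt (2 t)) e^{-t} / H_2n(0) with n = d - 1; by Sonin's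
   monotonicity argument its local extrema have modulus at least 1, and its k-th derivative
   at 0 is the sum in the theorem, up to sign. The same function with the variable scaled by
   lam < 1 and damped by e^{-(1 - lam) t} has norm 1 once d is large, which gives at least
   lam^k times the sum. *)

(** * Jets, products of operators D + a, and sign alternation *)

(** One exponent is changed at a time because, for two such neighbouring spaces, applying the d
    factors of the smaller exponents to q - c p removes p and leaves a single exponential of known
    sign. The d alternations and the extra zero at 0 are d + 1 points, just enough to force one sign
    after d factors, and the two signs collide. Positive exponents make all functions decay, so
    infinity acts as a further zero and differentiation loses no alternation point. At least one
    differentiation moves the first point strictly to the right of 0 and makes room for the extra
    zero there. The comparison is used with two functions q. S_d is itself admissible and gives the
    exact maximum. The Hermite function is explicit and gives the sum, but its peaks may exceed 1,
    so it is not admissible. A damping that costs only a factor close to 1 makes it admissible for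
    large d, whence the asymptotic equality. *)

Lemma finite_choice {A : Type} (a0 : A) (m : nat) (P : nat -> A -> Prop) :
  (forall i, (i < m)%nat -> exists y, P i y) ->
  exists f, forall i, (i < m)%nat -> P i (f i).
Proof.
induction m as [|m IH]; intros H.
- exists (fun _ => a0). intros; lia.
- destruct IH as [f Hf]; [intros; apply H; lia|].
  destruct (H m) as [y Hy]; [lia|].
  exists (fun i => if Nat.eq_dec i m then y else f i).
  intros i Hi. destruct (Nat.eq_dec i m) as [->|ne]; [exact Hy|apply Hf; lia].
Qed.

Lemma pow_m1_sqr (i : nat) : (-1) ^ i * (-1) ^ i = 1.
Proof. rewrite <- pow_add, <- (pow_1_even i). f_equal. lia. Qed.

Lemma pow_m1_neq0 (i : nat) : (-1) ^ i <> 0.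
Proof. apply pow_nonzero; lra. Qed.

Lemma derivable_pt_lim_ext (f g : R -> R) (t l : R) :
  (forall x, f x = g x) -> derivable_pt_lim f t l -> derivable_pt_lim g t l.
Proof.
intros H Hf eps Heps. destruct (Hf eps Heps) as [delta Hd].
exists delta. intros h h0 hd. rewrite <- !H. now apply Hd.
Qed.

Lemma derivable_pt_lim_exp_lin (a t : R) :
  derivable_pt_lim (fun x => exp (a * x)) t (a * exp (a * t)).
Proof.
rewrite (Rmult_comm a (exp _)).
apply (derivable_pt_lim_comp (fun x => a * x) exp); [|apply derivable_pt_lim_exp].
pose proof (derivable_pt_lim_scal id a t 1 (derivable_pt_lim_id t)) as H.
rewrite Rmult_1_r in H. exact H.
Qed.

Definition incr (m : nat) (x : nat -> R) : Prop :=
  forall i, (S i < m)%nat -> x i < x (S i).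

Lemma incr_lt (m : nat) (x : nat -> R) (i j : nat) :
  incr m x -> (i < j)%nat -> (j < m)%nat -> x i < x j.
Proof.
intros Hx Hij. induction Hij as [|j Hij IH]; intros Hj.
- now apply Hx.
- apply Rlt_trans with (x j); [apply IH; lia|apply Hx; lia].
Qed.

Definition prepend (y : R) (x : nat -> R) (i : nat) : R :=
  match i with O => y | S j => x j end.

Definition decays (f : R -> R) : Prop :=
  forall eps, 0 < eps -> exists K, forall t, K <= t -> Rabs (f t) < eps.

(* Applied to [e^{a t} f], whose derivative is [e^{a t} (f' + a f)]. *)
Lemma mean_value_exp (a : R) (f f' : R -> R) (x y : R) :
  (forall t, derivable_pt_lim f t (f' t)) -> x < y ->
  exists z, x < z < y /\ exists k1 k2, 0 < k1 /\ 0 < k2 /\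
    f' z + a * f z = k1 * f y - k2 * f x.
Proof.
intros Hf Hxy.
destruct (MVT_cor2 (fun t => exp (a * t) * f t)
  (fun t => a * exp (a * t) * f t + exp (a * t) * f' t) x y Hxy) as (z & Hz & Hin).
{ intros c _. apply (derivable_pt_lim_mult (fun t => exp (a * t)) f);
    [apply derivable_pt_lim_exp_lin|apply Hf]. }
exists z; split; [exact Hin|].
pose proof (exp_pos (a * z)) as Pz.
pose proof (exp_pos (a * x)) as Px. pose proof (exp_pos (a * y)) as Py.
assert (Pd : 0 < / (exp (a * z) * (y - x))).
{ apply Rinv_0_lt_compat, Rmult_lt_0_compat; lra. }
exists (exp (a * y) * / (exp (a * z) * (y - x))),
  (exp (a * x) * / (exp (a * z) * (y - x))).
split; [now apply Rmult_lt_0_compat|]. split; [now apply Rmult_lt_0_compat|].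
apply Rmult_eq_reg_l with (exp (a * z) * (y - x)).
- transitivity (exp (a * y) * f y - exp (a * x) * f x); [lra|field; lra].
- apply Rgt_not_eq, Rmult_lt_0_compat; lra.
Qed.

(** Keeping the value as a combination with positive weights lets one statement yield both sign
    alternation ([walt_step]) and zeros ([Op_zero]). *)
Lemma rolle_nodes (a : R) (f f' : R -> R) (m : nat) (x : nat -> R) :
  (forall t, derivable_pt_lim f t (f' t)) -> incr (S m) x ->
  exists y, forall i, (i < m)%nat -> x i < y i < x (S i) /\
    exists k1 k2, 0 < k1 /\ 0 < k2 /\
      f' (y i) + a * f (y i) = k1 * f (x (S i)) - k2 * f (x i).
Proof.
intros Hf Hx. apply (finite_choice 0 m (fun i z => x i < z < x (S i) /\
  exists k1 k2, 0 < k1 /\ 0 < k2 /\ f' z + a * f z = k1 * f (x (S i)) - k2 * f (x i))).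
intros i Hi. apply mean_value_exp; [exact Hf|apply Hx; lia].
Qed.

(** Weak alternation: zero values are allowed, because the point prepended later is a zero. The
    single nonzero value survives every step below and is what finally contradicts membership in a
    kernel. Only the sign of [s] matters. *)
Definition walt (m : nat) (s : R) (x : nat -> R) (f : R -> R) : Prop :=
  s <> 0 /\ incr m x /\ (forall i, (i < m)%nat -> 0 <= s * (-1) ^ i * f (x i)) /\
  exists i, (i < m)%nat /\ f (x i) <> 0.

Lemma walt_ext (m : nat) (s : R) (x : nat -> R) (f g : R -> R) :
  (forall t, f t = g t) -> walt m s x f -> walt m s x g.
Proof.
intros E (H1 & H2 & H3 & i & Hi & H4). repeat split; auto.
- intros j Hj. rewrite <- E. auto.
- exists i. rewrite <- E. auto.
Qed.

Lemma walt_prepend (m : nat) (s y : R) (x : nat -> R) (f : R -> R) :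
  y < x 0%nat -> s * f y <= 0 -> walt m s x f -> walt (S m) (- s) (prepend y x) f.
Proof.
intros Hy Hs (H1 & H2 & H3 & i & Hi & H4). repeat split.
- lra.
- intros [|j] Hj; simpl; [exact Hy|apply H2; lia].
- intros [|j] Hj; simpl; [lra|]. specialize (H3 j). assert (Hj' : (j < m)%nat) by lia.
  specialize (H3 Hj'). lra.
- exists (S i). simpl. split; [lia|exact H4].
Qed.

(** With [u] and [w] of opposite weak signs the two terms of [g] have the same weak sign and cannot
    cancel. *)
Lemma alt_sign_step (s k1 k2 u w g : R) :
  s <> 0 -> 0 < k1 -> 0 < k2 -> g = k1 * w - k2 * u ->
  0 <= s * u -> 0 <= - s * w ->
  0 <= - s * g /\ (u <> 0 \/ w <> 0 -> g <> 0).
Proof.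
intros Hs H1 H2 -> Hu Hw. split; [nra|].
intros Hor Hg.
assert (A : k1 * (- s * w) + k2 * (s * u) = 0).
{ replace (k1 * (- s * w) + k2 * (s * u)) with (- s * (k1 * w - k2 * u)) by ring.
  rewrite Hg. ring. }
assert (s * u = 0) by nra. assert (s * w = 0) by nra.
destruct Hor as [Hor|Hor]; apply Hor; apply Rmult_eq_reg_l with s; lra.
Qed.

(** Each factor D + a costs one point. That the first point moves to the right is recorded so that
    another one can be put in front. *)
Lemma walt_step (a : R) (f f' : R -> R) (m : nat) (s : R) (x : nat -> R) :
  (forall t, derivable_pt_lim f t (f' t)) -> walt (S (S m)) s x f ->
  exists y, x 0%nat < y 0%nat /\ walt (S m) (- s) y (fun t => f' t + a * f t).
Proof.
intros Hf (Hs & Hx & Hw & i & Hi & Hnz).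
destruct (rolle_nodes a f f' (S m) x Hf Hx) as [y Hy].
assert (Sg : forall j, (j < S m)%nat ->
  0 <= - s * (-1) ^ j * (f' (y j) + a * f (y j)) /\
  (f (x j) <> 0 \/ f (x (S j)) <> 0 -> f' (y j) + a * f (y j) <> 0)).
{ intros j Hj. destruct (Hy j Hj) as (_ & k1 & k2 & P1 & P2 & E).
  destruct (alt_sign_step (s * (-1) ^ j) k1 k2 _ _ _
    (Rmult_integral_contrapositive_currified _ _ Hs (pow_m1_neq0 j)) P1 P2 E) as [A B].
  - apply Hw; lia.
  - replace (- (s * (-1) ^ j)) with (s * (-1) ^ S j) by (simpl; ring). apply Hw; lia.
  - split; [|exact B].
    replace (- s * (-1) ^ j) with (- (s * (-1) ^ j)) by ring. exact A. }
exists y. split; [apply Hy; lia|]. repeat split.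
- lra.
- intros j Hj. apply Rlt_trans with (x (S j)); apply Hy; lia.
- intros j Hj. now apply Sg.
- destruct (Nat.eq_dec i (S m)) as [->|ne].
  + exists m. split; [lia|]. apply Sg; [lia|now right].
  + exists i. split; [lia|]. apply Sg; [lia|now left].
Qed.

Lemma decays_scal (c : R) (f : R -> R) : decays f -> decays (fun t => c * f t).
Proof.
intros Hf eps Heps.
destruct (Hf (eps / (Rabs c + 1))) as [K HK].
{ apply Rdiv_lt_0_compat; [lra|]. pose proof (Rabs_pos c); lra. }
exists K. intros t Ht. rewrite Rabs_mult. specialize (HK t Ht).
pose proof (Rabs_pos c). pose proof (Rabs_pos (f t)).
apply Rmult_lt_compat_r with (r := Rabs c + 1) in HK; [|lra].
unfold Rdiv in HK. rewrite Rmult_assoc, Rinv_l, Rmult_1_r in HK by lra. nra.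
Qed.

(** Decay replaces the right end point of Rolle's theorem: a positive value must come down again. *)
Lemma mean_value_at_infinity (f f' : R -> R) (x : R) :
  (forall t, derivable_pt_lim f t (f' t)) -> decays f -> 0 <= f x ->
  exists y, x < y /\ f' y <= 0 /\ (f x <> 0 -> f' y < 0).
Proof.
intros Hf Hd.
assert (Pos : forall z, 0 < f z -> exists y, z < y /\ f' y < 0).
{ intros z Hz. destruct (Hd (f z) Hz) as [K HK].
  pose proof (Rmax_l K (z + 1)) as M1. pose proof (Rmax_r K (z + 1)) as M2.
  destruct (MVT_cor2 f f' z (Rmax K (z + 1))) as (y & Ey & Hy); [lra|intros; apply Hf|].
  exists y. split; [lra|]. specialize (HK _ M1). apply Rabs_def2 in HK.
  assert (f' y * (Rmax K (z + 1) - z) < 0) by lra. nra. }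
intros [Hx|Hx].
- destruct (Pos x Hx) as (y & Hy & Hn). exists y. repeat split; lra.
- destruct (Rlt_le_dec 0 (f (x + 1))) as [H1|H1].
  + destruct (Pos _ H1) as (y & Hy & Hn). exists y. repeat split; lra.
  + destruct (MVT_cor2 f f' x (x + 1)) as (y & Ey & Hy); [lra|intros; apply Hf|].
    exists y. split; [lra|]. split; [nra|]. intros; lra.
Qed.

(** Infinity supplies the missing last point, so the derivative has as many alternation points as
    the function. Nonvanishing is tracked point by point, because [laguerre_alternation] needs
    strict signs everywhere. *)
Lemma alternation_at_infinity (f f' : R -> R) (m : nat) (s : R) (x : nat -> R) :
  (forall t, derivable_pt_lim f t (f' t)) -> decays f ->
  s <> 0 -> incr (S m) x -> (forall i, (i <= m)%nat -> 0 <= s * (-1) ^ i * f (x i)) ->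
  exists y, incr (S m) y /\ (forall i, (i <= m)%nat -> x i < y i /\
     0 <= - s * (-1) ^ i * f' (y i) /\
    (f (x i) <> 0 \/ (i < m)%nat /\ f (x (S i)) <> 0 -> f' (y i) <> 0)).
Proof.
intros Hf Hd Hs Hx Hw.
destruct (rolle_nodes 0 f f' m x Hf Hx) as [y Hy].
assert (Hm : s * (-1) ^ m <> 0)
  by exact (Rmult_integral_contrapositive_currified _ _ Hs (pow_m1_neq0 m)).
destruct (mean_value_at_infinity (fun t => (s * (-1) ^ m) * f t)
  (fun t => (s * (-1) ^ m) * f' t) (x m)) as (z & Hz & Sz & Nz).
{ intros t. apply derivable_pt_lim_scal, Hf. }
{ now apply decays_scal. }
{ apply Hw; lia. }
exists (fun i => if Nat.eq_dec i m then z else y i). split.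
- intros i Hi. destruct (Nat.eq_dec i m); [lia|].
  destruct (Nat.eq_dec (S i) m) as [e|ne].
  + apply Rlt_trans with (x m); [rewrite <- e; apply Hy; lia|exact Hz].
  + apply Rlt_trans with (x (S i)); apply Hy; lia.
- intros i Hi. destruct (Nat.eq_dec i m) as [->|ne].
  + split; [exact Hz|]. split; [lra|].
    intros [H|H]; [|lia]. intros E. rewrite E in Nz.
    assert (s * (-1) ^ m * f (x m) <> 0)
      by (apply Rmult_integral_contrapositive_currified; assumption).
    specialize (Nz H0). lra.
  + assert (Hi' : (i < m)%nat) by lia.
    destruct (Hy i Hi') as (B & k1 & k2 & P1 & P2 & E). rewrite Rmult_0_l, Rplus_0_r in E.
    destruct (alt_sign_step (s * (-1) ^ i) k1 k2 _ _ _
      (Rmult_integral_contrapositive_currified _ _ Hs (pow_m1_neq0 i)) P1 P2 E) as [A C].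
    * apply Hw; lia.
    * replace (- (s * (-1) ^ i)) with (s * (-1) ^ S i) by (simpl; ring). apply Hw; lia.
    * split; [lra|]. split.
      -- replace (- s * (-1) ^ i) with (- (s * (-1) ^ i)) by ring. exact A.
      -- intros [H|[_ H]]; apply C; auto.
Qed.

Lemma walt_at_infinity (f f' : R -> R) (m : nat) (s : R) (x : nat -> R) :
  (forall t, derivable_pt_lim f t (f' t)) -> decays f -> walt (S m) s x f ->
  exists y, x 0%nat < y 0%nat /\ walt (S m) (- s) y f'.
Proof.
intros Hf Hd (Hs & Hx & Hw & i & Hi & Hnz).
destruct (alternation_at_infinity f f' m s x Hf Hd Hs Hx) as (y & Iy & Hy).
{ intros j Hj. apply Hw. lia. }
exists y. split; [apply Hy; lia|]. repeat split.
- lra.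
- exact Iy.
- intros j Hj. apply Hy. lia.
- exists i. split; [exact Hi|]. apply Hy; [lia|now left].
Qed.

(* A smooth function is handled as the sequence [F] of its derivatives. *)
Definition jet (F : nat -> R -> R) : Prop :=
  forall n t, derivable_pt_lim (F n) t (F (S n) t).

(* [Op [a_1; ...; a_m] F] is the jet of [(D + a_1) ... (D + a_m) F]. *)
Fixpoint Op (l : list R) (F : nat -> R -> R) (n : nat) (t : R) : R :=
  match l with
  | [] => F n t
  | a :: l' => Op l' (fun n t => F (S n) t + a * F n t) n t
  end.

(* For [l = h_1, ..., h_d] this is the space P_h. *)
Definition ker (l : list R) (F : nat -> R -> R) : Prop := forall n t, Op l F n t = 0.

Lemma jet_lin (F G : nat -> R -> R) (al be : R) :
  jet F -> jet G -> jet (fun n t => al * F n t + be * G n t).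
Proof.
intros HF HG n t.
apply (derivable_pt_lim_plus (fun t => al * F n t) (fun t => be * G n t));
  apply derivable_pt_lim_scal; auto.
Qed.

Lemma jet_step (a : R) (F : nat -> R -> R) :
  jet F -> jet (fun n t => F (S n) t + a * F n t).
Proof.
intros HF n t. apply (derivable_pt_lim_plus (F (S n)) (fun t => a * F n t)); [apply HF|].
apply derivable_pt_lim_scal, HF.
Qed.

Lemma jet_shift (k : nat) (F : nat -> R -> R) : jet F -> jet (fun n => F (k + n)%nat).
Proof. intros HF n t. rewrite Nat.add_succ_r. apply HF. Qed.

Lemma Op_ext (l : list R) (F G : nat -> R -> R) :
  (forall n t, F n t = G n t) -> forall n t, Op l F n t = Op l G n t.
Proof.
revert F G. induction l as [|a l IH]; intros F G H n t; simpl; [apply H|].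
apply IH. intros. now rewrite !H.
Qed.

Lemma Op_lin (l : list R) (F G : nat -> R -> R) (al be : R) (n : nat) (t : R) :
  Op l (fun n t => al * F n t + be * G n t) n t = al * Op l F n t + be * Op l G n t.
Proof.
revert F G. induction l as [|a l IH]; intros F G; simpl; [reflexivity|].
rewrite <- IH. apply Op_ext. intros; ring.
Qed.

Lemma Op_shift (l : list R) (k : nat) (F : nat -> R -> R) (n : nat) (t : R) :
  Op l (fun n => F (k + n)%nat) n t = Op l F (k + n)%nat t.
Proof.
revert F. induction l as [|a l IH]; intros F; simpl; [reflexivity|].
rewrite <- (IH (fun n t => F (S n) t + a * F n t)). apply Op_ext.
intros. now rewrite Nat.add_succ_r.
Qed.

Lemma Op_perm (l l' : list R) : Permutation l l' ->
  forall F n t, Op l F n t = Op l' F n t.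
Proof.
intros P. induction P as [|a l l' P IH|a b l|l l' l'' P1 IH1 P2 IH2]; intros F n t; simpl.
- reflexivity.
- apply IH.
- apply Op_ext. intros; ring.
- now rewrite IH1.
Qed.

(** [Op] applies the head of the list first; since the factors commute, it can also be applied last,
    to [Op l F]. *)
Lemma Op_snoc (l : list R) (a : R) (F : nat -> R -> R) (n : nat) (t : R) :
  Op (a :: l) F n t = Op l F (S n) t + a * Op l F n t.
Proof.
simpl. replace (Op l F (S n) t) with (1 * Op l (fun n => F (1 + n)%nat) n t)
  by (rewrite (Op_shift l 1); simpl; ring).
rewrite <- Op_lin. apply Op_ext. intros; simpl; ring.
Qed.

Lemma jet_Op (l : list R) (F : nat -> R -> R) : jet F -> jet (Op l F).
Proof.
revert F. induction l as [|a l IH]; intros F HF; simpl; [exact HF|].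
apply IH. now apply jet_step.
Qed.

Lemma ker_lin (l : list R) (F G : nat -> R -> R) (al be : R) :
  ker l F -> ker l G -> ker l (fun n t => al * F n t + be * G n t).
Proof. intros HF HG n t. rewrite Op_lin, HF, HG. ring. Qed.

Lemma ker_cons (l : list R) (a : R) (F : nat -> R -> R) : ker l F -> ker (a :: l) F.
Proof. intros HF n t. rewrite Op_snoc, !HF. ring. Qed.

Lemma walt_Op (l : list R) (m : nat) (s : R) (x : nat -> R) (F : nat -> R -> R) :
  jet F -> walt (length l + S m) s x (F 0%nat) ->
  exists y, walt (S m) (s * (-1) ^ length l) y (Op l F 0%nat).
Proof.
revert s x F. induction l as [|a l IH]; intros s x F HF Hw.
- exists x. simpl in *. now rewrite Rmult_1_r.
- simpl in Hw. rewrite Nat.add_succ_r in Hw.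
  destruct (walt_step a (F 0%nat) (F 1%nat) _ s x (HF 0%nat) Hw) as (y & _ & Hy).
  rewrite <- Nat.add_succ_r in Hy.
  destruct (IH _ _ _ (jet_step a F HF) Hy) as [z Hz].
  exists z. simpl. replace (s * (-1 * (-1) ^ length l)) with (- s * (-1) ^ length l) by ring.
  exact Hz.
Qed.

(** The Chebyshev property of these spaces: after all factors one nonzero value would remain of a
    function that has become 0. *)
Lemma ker_no_walt (l : list R) (s : R) (x : nat -> R) (F : nat -> R -> R) :
  jet F -> ker l F -> ~ walt (S (length l)) s x (F 0%nat).
Proof.
intros HF HK Hw. rewrite <- Nat.add_1_r in Hw.
destruct (walt_Op l 0 s x F HF Hw) as (y & _ & _ & _ & i & _ & Hn).
now apply Hn, HK.
Qed.

Lemma decays_ode (a : R) (f f' : R -> R) :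
  0 < a -> (forall t, derivable_pt_lim f t (f' t)) ->
  decays (fun t => f' t + a * f t) -> decays f.
Proof.
(* One-sided estimate: e^{a t} (f - eps) is nonincreasing beyond K. It is applied to f and to -f. *)
assert (Half : forall (f f' : R -> R), 0 < a ->
  (forall t, derivable_pt_lim f t (f' t)) ->
  forall eps K, (forall t, K <= t -> f' t + a * f t < a * eps) ->
  forall t, K <= t -> exp (a * t) * (f t - eps) <= exp (a * K) * (f K - eps)).
{ clear f f'. intros f f' Ha Hf eps K HK t [Ht| <-]; [|lra].
  destruct (MVT_cor2 (fun t => exp (a * t) * (f t - eps))
    (fun t => a * exp (a * t) * (f t - eps) + exp (a * t) * (f' t - 0)) K t Ht)
    as (z & Hz & Hin).
  { intros c _. apply (derivable_pt_lim_mult (fun t => exp (a * t)) (fun t => f t - eps));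
      [apply derivable_pt_lim_exp_lin|].
    apply (derivable_pt_lim_minus f (fun _ => eps)); [apply Hf|apply derivable_pt_lim_const]. }
  assert (f' z + a * f z < a * eps) by (apply HK; lra).
  pose proof (exp_pos (a * z)).
  assert (a * exp (a * z) * (f z - eps) + exp (a * z) * (f' z - 0) <= 0).
  { replace (a * exp (a * z) * (f z - eps) + exp (a * z) * (f' z - 0))
      with (exp (a * z) * (f' z + a * f z - a * eps)) by ring. nra. }
  nra. }
intros Ha Hf Hd eps Heps.
destruct (Hd (a * (eps / 2))) as [K HK].
{ apply Rmult_lt_0_compat; lra. }
set (C := Rabs (f K) + eps / 2). assert (HC : 0 < C) by (unfold C; pose proof (Rabs_pos (f K)); lra).
(* [C] bounds the excess at K; by exp x >= 1 + x, beyond this point e^{a (t - K)} > 2 C / eps, so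
   the excess is below eps / 2. *)
exists (K + 2 * C / eps / a). intros t Ht.
assert (Hq : 0 < 2 * C / eps / a).
{ unfold Rdiv. repeat apply Rmult_lt_0_compat; try lra; apply Rinv_0_lt_compat; lra. }
assert (U := Half f f' Ha Hf (eps / 2) K).
assert (L := Half (fun t => - f t) (fun t => - f' t) Ha
  (fun t => derivable_pt_lim_opp _ _ _ (Hf t)) (eps / 2) K).
specialize (fun H => U H t ltac:(lra)). specialize (fun H => L H t ltac:(lra)).
assert (U' := U (fun u Hu => Rle_lt_trans _ _ _ (Rle_abs _) (HK u Hu))). clear U.
assert (L' : exp (a * t) * (- f t - eps / 2) <= exp (a * K) * (- f K - eps / 2)).
{ apply L. intros u Hu. specialize (HK u Hu). apply Rabs_def2 in HK. lra. }
clear L.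
assert (Ex : exp (a * t) = exp (a * K) * exp (a * (t - K))) by (rewrite <- exp_plus; f_equal; ring).
assert (G : 2 * C / eps < exp (a * (t - K))).
{ assert (2 * C / eps <= a * (t - K)).
  { apply Rle_trans with (a * (2 * C / eps / a)); [right; field; lra|].
    apply Rmult_le_compat_l; lra. }
  pose proof (exp_ineq1_le (a * (t - K))). lra. }
assert (G' : 2 * C < eps * exp (a * (t - K))).
{ apply Rmult_lt_compat_l with (r := eps) in G; [|lra].
  replace (eps * (2 * C / eps)) with (2 * C) in G by (field; lra). exact G. }
pose proof (exp_pos (a * K)) as PK. rewrite Ex, Rmult_assoc in U', L'.
apply Rmult_le_reg_l in U'; [|exact PK]. apply Rmult_le_reg_l in L'; [|exact PK].
pose proof (exp_pos (a * (t - K))).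
assert (- C <= f K - eps / 2 <= C /\ - C <= - f K - eps / 2 <= C).
{ unfold C. pose proof (Rle_abs (f K)). pose proof (Rle_abs (- f K)). rewrite Rabs_Ropp in *. lra. }
apply Rabs_def1; nra.
Qed.

Lemma decays_ext (f g : R -> R) : (forall t, f t = g t) -> decays f -> decays g.
Proof. intros E H eps He. destruct (H eps He) as [K HK]. exists K. intros. rewrite <- E. auto. Qed.

Lemma ker_decays (l : list R) (F : nat -> R -> R) (n : nat) :
  (forall a, In a l -> 0 < a) -> jet F -> ker l F -> decays (F n).
Proof.
revert F. induction l as [|a l IH]; intros F Hl HF HK.
- intros eps He. exists 0. intros t _. rewrite (HK n t : F n t = 0). now rewrite Rabs_R0.
- apply decays_ode with a (F (S n)); [apply Hl; now left|apply HF|].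
  apply (IH (fun n t => F (S n) t + a * F n t)).
  + intros b Hb. apply Hl. now right.
  + now apply jet_step.
  + exact HK.
Qed.

(** The order is [S k] because at least one differentiation is needed for the first point to move
    strictly to the right. *)
Lemma walt_jet_at_infinity (F : nat -> R -> R) (m k : nat) (s : R) (x : nat -> R) :
  jet F -> (forall n, decays (F n)) -> walt (S m) s x (F 0%nat) ->
  exists y, x 0%nat < y 0%nat /\ walt (S m) (s * (-1) ^ S k) y (F (S k)).
Proof.
intros HF Hd Hw. induction k as [|k (y & Hy & IH)].
- destruct (walt_at_infinity _ _ m s x (HF 0%nat) (Hd 0%nat) Hw) as (y & Hy & H).
  exists y. split; [exact Hy|]. replace (s * (-1) ^ 1) with (- s) by ring. exact H.
- destruct (walt_at_infinity _ _ m _ y (HF (S k)) (Hd (S k)) IH) as (z & Hz & H).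
  exists z. split; [lra|].
  replace (s * (-1) ^ S (S k)) with (- (s * (-1) ^ S k)) by (simpl; ring). exact H.
Qed.

Lemma exp_ode (b : R) (f : R -> R) (x t : R) :
  (forall t, derivable_pt_lim f t (- b * f t)) -> f t = exp (b * (x - t)) * f x.
Proof.
intros Hf.
assert (Lt : forall x t, x < t -> exp (b * t) * f t = exp (b * x) * f x).
{ clear x t. intros x t Hxt.
  destruct (MVT_cor2 (fun t => exp (b * t) * f t)
    (fun t => b * exp (b * t) * f t + exp (b * t) * (- b * f t)) x t Hxt) as (z & Hz & _).
  { intros c _. apply (derivable_pt_lim_mult (fun t => exp (b * t)) f);
      [apply derivable_pt_lim_exp_lin|apply Hf]. }
  replace (b * exp (b * z) * f z + exp (b * z) * (- b * f z)) with 0 in Hz by ring.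
  lra. }
assert (Eq : exp (b * t) * f t = exp (b * x) * f x).
{ destruct (Rtotal_order x t) as [H|[->|H]]; [auto|reflexivity|symmetry; auto]. }
apply Rmult_eq_reg_l with (exp (b * t)); [|apply Rgt_not_eq, exp_pos].
rewrite Eq, <- Rmult_assoc, <- exp_plus. do 2 f_equal. ring.
Qed.

Lemma ker_singleton (b : R) (u : nat -> R -> R) :
  jet u -> ker [b] u ->
  (forall n t, u n t = (- b) ^ n * u 0%nat t) /\
  forall x t, u 0%nat t = exp (b * (x - t)) * u 0%nat x.
Proof.
intros Hu HK. assert (E : forall n t, u (S n) t = - b * u n t).
{ intros n t. specialize (HK n t). simpl in HK. lra. }
split.
- intros n t. induction n as [|n IH]; [simpl; ring|]. rewrite E, IH. simpl; ring.
- intros x t. apply exp_ode. intros z. rewrite <- E. apply Hu.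
Qed.

(* If the claim failed, some [D = q - c p] with [|c| < 1] would have [D^(k)(0) = 0]; that
   zero, put in front of the alternation which [D^(k)] inherits from [D], makes the sign of
   [(D + a) l(D) D^(k)] opposite to the one forced by [a <= b]. *)
Lemma exponent_increase (l : list R) (a b : R) (k : nat) (nu : nat -> R)
    (P Q : nat -> R -> R) :
  0 < a -> a <= b -> (forall c, In c l -> 0 < c) ->
  jet P -> jet Q -> ker (a :: l) P -> ker (b :: l) Q ->
  nu 0%nat = 0 -> incr (S (length l)) nu ->
  (forall i, (i <= length l)%nat -> Rabs (P 0%nat (nu i)) <= 1) ->
  (forall i, (i <= length l)%nat -> 1 <= - (-1) ^ i * Q 0%nat (nu i)) ->
  Rabs (P (S k) 0) <= Rabs (Q (S k) 0).
Proof.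
intros Ha Hab Hl JP JQ KP KQ Hn0 Hnu HP HQ.
destruct (Rle_lt_dec (Rabs (P (S k) 0)) (Rabs (Q (S k) 0))) as [|Hlt]; [assumption|exfalso].
set (m := length l) in *.
assert (HP0 : P (S k) 0 <> 0).
{ intros E. rewrite E, Rabs_R0 in Hlt. pose proof (Rabs_pos (Q (S k) 0)). lra. }
set (c := Q (S k) 0 / P (S k) 0).
assert (Hc : Rabs c < 1).
{ unfold c, Rdiv. rewrite Rabs_mult, Rabs_inv.
  pose proof (Rabs_pos_lt _ HP0).
  apply Rmult_lt_reg_r with (Rabs (P (S k) 0)); [lra|].
  rewrite Rmult_assoc, Rinv_l; lra. }
(* [c] is chosen so that the derivative of order [S k] of D vanishes at 0; as |c| < 1, D keeps the
   signs of Q at the nodes. *)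
set (D := fun n t => 1 * Q n t + (- c) * P n t).
assert (JD : jet D) by (apply jet_lin; assumption).
assert (KD : ker (a :: b :: l) D).
{ apply ker_lin; [|].
  - now apply ker_cons.
  - intros n t. rewrite (Op_perm _ (b :: a :: l) (perm_swap _ _ _)). revert n t.
    now apply ker_cons. }
assert (DD : forall n, decays (D n)).
{ intros n. apply ker_decays with (a :: b :: l); [|assumption|assumption].
  intros e [<-|[<-|He]]; [lra|lra|auto]. }
assert (WD : walt (S m) (-1) nu (D 0%nat)).
{ assert (Pos : forall i, (i <= m)%nat -> 0 < -1 * (-1) ^ i * D 0%nat (nu i)).
  { intros i Hi. specialize (HP i Hi). specialize (HQ i Hi). unfold D.
    assert (Rabs ((-1) ^ i * c * P 0%nat (nu i)) < 1).
    { rewrite !Rabs_mult, pow_1_abs. pose proof (Rabs_pos c).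
      pose proof (Rabs_pos (P 0%nat (nu i))). nra. }
    apply Rabs_def2 in H. nra. }
  repeat split; [lra|exact Hnu| |].
  - intros i Hi. left. apply Pos; lia.
  - exists 0%nat. split; [lia|]. intros E. specialize (Pos 0%nat ltac:(lia)).
    rewrite E in Pos. lra. }
destruct (walt_jet_at_infinity D m k (-1) nu JD DD WD) as (y & Hy & Wy).
rewrite Hn0 in Hy.
assert (WG := walt_prepend _ _ 0 y (D (S k)) Hy
  ltac:(unfold D, c; right; field; exact HP0) Wy).
set (G := fun n => D (S k + n)%nat).
assert (JG : jet G) by (apply jet_shift; assumption).
replace (D (S k)) with (G 0%nat) in WG by (unfold G; f_equal; lia).
assert (WG' : walt (length (a :: l) + 1) (- (-1 * (-1) ^ S k)) (prepend 0 y) (G 0%nat)).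
{ simpl length. fold m. replace (S m + 1)%nat with (S (S m)) by lia. exact WG. }
destruct (walt_Op (a :: l) 0 _ _ G JG WG') as (z & _ & _ & Sz & i & Hi & Nz).
assert (i = 0%nat) by lia; subst i.
specialize (Sz 0%nat ltac:(lia)).
assert (JU : jet (Op l Q)) by (now apply jet_Op).
assert (KU : ker [b] (Op l Q)) by (intros n t; rewrite <- (KQ n t); symmetry; apply Op_snoc).
destruct (ker_singleton b _ JU KU) as [E1 E2].
(* The operator annihilates P. On Q it leaves D + a applied to derivatives of a solution of u' = - b
   u, hence the factor a - b. *)
assert (EG : Op (a :: l) G 0%nat (z 0%nat) = (- b) ^ S k * (a - b) * Op l Q 0%nat (z 0%nat)).
{ unfold G. rewrite (Op_shift (a :: l) (S k)), Nat.add_0_r. unfold D. rewrite Op_lin, (KP (S k)).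
  rewrite Op_snoc, (E1 (S (S k))), (E1 (S k)). simpl. ring. }
(* [Op l Q] is a multiple of e^{-b t}, so its sign is constant and can be read off at another point,
   from the alternation of Q itself. *)
assert (WQ : walt (length l + 1) (-1) nu (Q 0%nat)).
{ fold m. rewrite Nat.add_1_r. repeat split; [lra|exact Hnu| |].
  - intros i Hi'. specialize (HQ i ltac:(lia)). lra.
  - exists 0%nat. split; [lia|]. intros E. specialize (HQ 0%nat ltac:(lia)). rewrite E in HQ. lra. }
destruct (walt_Op l 0 _ _ Q JQ WQ) as (w & _ & _ & Sw & i & Hi' & Nw).
assert (i = 0%nat) by lia; subst i. specialize (Sw 0%nat ltac:(lia)).
rewrite (E2 (w 0%nat) (z 0%nat)) in EG.
pose proof (exp_pos (b * (w 0%nat - z 0%nat))) as Pe.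
rewrite EG in Sz, Nz. simpl length in Sz. fold m in Sz, Sw. simpl pow in Sz, Sw.
set (X := Op l Q 0%nat (w 0%nat)) in *. set (ex := exp _) in *.
assert (Hb : 0 < b ^ k) by (apply pow_lt; lra).
assert (Bk : (- b) ^ k = (-1) ^ k * b ^ k) by (rewrite <- Rpow_mult_distr; f_equal; ring).
replace (- (-1 * (-1 * (-1) ^ k)) * (-1 * (-1) ^ m) * 1 *
  (- b * (- b) ^ k * (a - b) * (ex * X)))
  with (((-1) ^ k * (-1) ^ k) * (b * b ^ k * ex * (b - a)) * ((-1) ^ m * X)) in Sz
  by (rewrite Bk; ring).
rewrite pow_m1_sqr, Rmult_1_l in Sz.
assert (HA : 0 <= b * b ^ k * ex * (b - a)).
{ repeat apply Rmult_le_pos; lra. }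
assert (HB : (-1) ^ m * X <= 0) by lra.
apply Nz. simpl.
(* The two signs are opposite, so the product vanishes, against the nonzero value kept by the
   alternation of G. *)
assert (Z : b * b ^ k * ex * (b - a) * ((-1) ^ m * X) = 0).
{ apply Rle_antisym; [|exact Sz]. nra. }
apply Rmult_integral in Z. destruct Z as [Z|Z].
- replace (- b * (- b) ^ k * (a - b) * (ex * X)) with
   ((-1) ^ k * (b * b ^ k * ex * (b - a)) * X) by (rewrite Bk; ring).
  rewrite Z. ring.
- apply Rmult_integral in Z. destruct Z as [Z|Z]; [now apply pow_m1_neq0 in Z|].
  rewrite Z. ring.
Qed.

(** * Interpolation and comparison of exponents *)

Lemma sumR_S (n : nat) (f : nat -> R) : sumR (S n) f = sumR n f + f n.
Proof.
unfold sumR. rewrite seq_S, map_app, fold_right_app. simpl. rewrite Rplus_0_r.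
generalize (map f (seq 0 n)). intros l. induction l as [|x l IH]; simpl; [ring|].
rewrite IH. ring.
Qed.

Lemma sumR_ext (n : nat) (f g : nat -> R) :
  (forall i, (i < n)%nat -> f i = g i) -> sumR n f = sumR n g.
Proof.
induction n as [|n IH]; intros H; [reflexivity|].
rewrite !sumR_S, IH, H; auto with arith.
Qed.

Lemma sumR_le (n : nat) (f g : nat -> R) :
  (forall i, (i < n)%nat -> f i <= g i) -> sumR n f <= sumR n g.
Proof.
induction n as [|n IH]; intros H; [apply Rle_refl|].
rewrite !sumR_S. apply Rplus_le_compat; auto with arith.
Qed.

Lemma sumR_scal (n : nat) (c : R) (f : nat -> R) : sumR n (fun i => c * f i) = c * sumR n f.
Proof. induction n as [|n IH]; [unfold sumR; simpl; ring|]. rewrite !sumR_S, IH. ring. Qed.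

Lemma sumR_plus (n : nat) (f g : nat -> R) :
  sumR n (fun i => f i + g i) = sumR n f + sumR n g.
Proof. induction n as [|n IH]; [unfold sumR; simpl; ring|]. rewrite !sumR_S, IH. ring. Qed.

Lemma sumR_split_first (n : nat) (f : nat -> R) :
  sumR (S n) f = f 0%nat + sumR n (fun i => f (S i)).
Proof.
induction n as [|n IH]; [unfold sumR; simpl; ring|].
rewrite sumR_S, IH, (sumR_S n). ring.
Qed.

Lemma sumR_pos (n : nat) (f : nat -> R) :
  (forall i, (i < n)%nat -> 0 <= f i) -> 0 <= sumR n f.
Proof.
induction n as [|n IH]; intros H; [apply Rle_refl|].
rewrite sumR_S. apply Rplus_le_le_0_compat; auto with arith.
Qed.

Lemma derivable_pt_lim_exp_opp (a t : R) :
  derivable_pt_lim (fun x => exp (- a * x)) t (- a * exp (- a * t)).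
Proof. apply derivable_pt_lim_exp_lin. Qed.

(* The [n]-th derivative of [t^m e^{-a t}]. *)
Fixpoint mono_exp (a : R) (m n : nat) (t : R) : R :=
  match n with
  | O => t ^ m * exp (- a * t)
  | S n' => INR m * mono_exp a (pred m) n' t - a * mono_exp a m n' t
  end.

Lemma jet_mono_exp (a : R) (m : nat) : jet (mono_exp a m).
Proof.
intros n. revert m. induction n as [|n IH]; intros m t.
- replace (mono_exp a m 1 t) with
    (INR m * t ^ pred m * exp (- a * t) + t ^ m * (- a * exp (- a * t))) by (simpl; ring).
  apply (derivable_pt_lim_mult (fun t => t ^ m) (fun t => exp (- a * t)));
    [apply derivable_pt_lim_pow|apply derivable_pt_lim_exp_opp].
- apply (derivable_pt_lim_minus (fun t => INR m * mono_exp a (pred m) n t)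
    (fun t => a * mono_exp a m n t)); apply derivable_pt_lim_scal, IH.
Qed.

Definition cnt (a : R) (l : list R) : nat :=
  length (filter (fun b => if Req_EM_T b a then true else false) l).

Lemma Op_mono_exp_cons (a b : R) (l : list R) (m n : nat) (t : R) :
  Op (b :: l) (mono_exp a m) n t =
  INR m * Op l (mono_exp a (pred m)) n t + (b - a) * Op l (mono_exp a m) n t.
Proof. simpl. rewrite <- Op_lin. apply Op_ext. intros; simpl; ring. Qed.

Lemma ker_mono_exp (a : R) (l : list R) (m : nat) :
  (m < cnt a l)%nat -> ker l (mono_exp a m).
Proof.
revert m. induction l as [|b l IH]; intros m Hm n t; [inversion Hm|].
rewrite Op_mono_exp_cons. unfold cnt in Hm. simpl in Hm.
destruct (Req_EM_T b a) as [->|_]; simpl in Hm; fold (cnt a l) in Hm.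
- replace (a - a) with 0 by ring. destruct m as [|m]; [simpl; ring|].
  simpl pred. rewrite IH by lia. ring.
- rewrite !IH by lia. ring.
Qed.

(** The first power of t which the factors in [l] do not annihilate; it provides the new function
    when [a] is added to [l]. *)
Lemma Op_mono_exp_cnt (a : R) (l : list R) :
  exists C, C <> 0 /\ forall t, Op l (mono_exp a (cnt a l)) 0%nat t = C * exp (- a * t).
Proof.
induction l as [|b l (C & HC & IH)].
- exists 1. split; [lra|]. intros t. simpl. ring.
- unfold cnt. cbn [filter].
  destruct (Req_EM_T b a) as [->|Hb]; cbn [length]; fold (cnt a l).
  + exists (INR (S (cnt a l)) * C).
    split; [apply Rmult_integral_contrapositive_currified; [apply not_0_INR; lia|exact HC]|].
    intros t. rewrite (Op_mono_exp_cons a a l (S (cnt a l)) 0 t). simpl pred. rewrite IH. ring.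
  + exists ((b - a) * C).
    split; [apply Rmult_integral_contrapositive_currified; [lra|exact HC]|].
    intros t. rewrite (Op_mono_exp_cons a b l (cnt a l) 0 t), IH.
    destruct (Nat.eq_dec (cnt a l) 0) as [->|H]; [simpl; ring|].
    rewrite (ker_mono_exp a l) by lia. ring.
Qed.

Lemma Op_zero (l : list R) (m : nat) (x : nat -> R) (F : nat -> R -> R) :
  jet F -> incr (length l + m) x ->
  (forall i, (i < length l + m)%nat -> F 0%nat (x i) = 0) ->
  exists y, forall i, (i < m)%nat -> Op l F 0%nat (y i) = 0.
Proof.
revert F x. induction l as [|a l IH]; intros F x HF Hx H0; [now exists x|].
destruct (rolle_nodes a (F 0%nat) (F 1%nat) (length l + m) x (HF 0%nat) Hx) as [y Hy].
apply (IH _ y (jet_step a F HF)).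
- intros i Hi. apply Rlt_trans with (x (S i)); apply Hy; lia.
- intros i Hi. destruct (Hy i Hi) as (_ & k1 & k2 & _ & _ & E).
  rewrite E, !H0 by (simpl; lia). ring.
Qed.

(** Newton's scheme: V interpolates at the earlier nodes, and F belongs to the larger kernel and
    vanishes there. F does not vanish at the last node, since otherwise Rolle would give a zero of
    [Op l F], which is a nonzero multiple of an exponential. *)
Lemma interpolation (l : list R) (x v : nat -> R) :
  incr (length l) x ->
  exists F, jet F /\ ker l F /\ forall i, (i < length l)%nat -> F 0%nat (x i) = v i.
Proof.
revert v. induction l as [|a l IH]; intros v Hx.
- exists (fun _ _ => 0). split; [|split].
  + intros n t. apply derivable_pt_lim_const.
  + intros n t. reflexivity.
  + simpl; intros; lia.
- assert (Hx' : incr (length l) x) by (intros i Hi; apply Hx; simpl; lia).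
  destruct (Op_mono_exp_cnt a l) as (C & HC & EC).
  set (m := cnt a l) in *.
  destruct (IH (fun i => mono_exp a m 0 (x i)) Hx') as (I & JI & KI & EI).
  destruct (IH v Hx') as (V & JV & KV & EV).
  set (F := fun n t => 1 * mono_exp a m n t + (- 1) * I n t).
  assert (JF : jet F) by (apply jet_lin; [apply jet_mono_exp|exact JI]).
  assert (HF : forall i, (i < length l)%nat -> F 0%nat (x i) = 0).
  { intros i Hi. unfold F. rewrite EI by exact Hi. ring. }
  assert (Hn : F 0%nat (x (length l)) <> 0).
  { intros E. destruct (Op_zero l 1 x F JF) as [y Hy].
    - simpl in Hx. now rewrite Nat.add_1_r.
    - intros i Hi. destruct (Nat.eq_dec i (length l)) as [->|ne]; [exact E|apply HF; lia].
    - specialize (Hy 0%nat ltac:(lia)). unfold F in Hy. rewrite Op_lin, KI, EC in Hy.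
      pose proof (exp_pos (- a * y 0%nat)).
      assert (C * exp (- a * y 0%nat) <> 0); [|lra].
      apply Rmult_integral_contrapositive_currified; lra. }
  set (k := (v (length l) - V 0%nat (x (length l))) / F 0%nat (x (length l))).
  exists (fun n t => 1 * V n t + k * F n t). split; [|split].
  + now apply jet_lin.
  + apply ker_lin; [now apply ker_cons|].
    apply ker_lin; [|now apply ker_cons].
    apply ker_mono_exp. unfold m, cnt. simpl. destruct (Req_EM_T a a); [simpl; lia|lra].
  + intros i Hi. simpl in Hi. destruct (Nat.eq_dec i (length l)) as [->|ne].
    * unfold k. field. exact Hn.
    * rewrite HF, EV by lia. ring.
Qed.

Lemma cnt_app (a : R) (l l' : list R) : cnt a (l ++ l') = (cnt a l + cnt a l')%nat.
Proof. unfold cnt. now rewrite filter_app, length_app. Qed.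

Lemma mult_cnt (h : nat -> R) (i : nat) : mult h i = cnt (h i) (map h (seq 0 i)).
Proof.
unfold mult, cnt. generalize (seq 0 i). intros s. induction s as [|j s IH]; [reflexivity|].
simpl. destruct (Req_EM_T (h j) (h i)); simpl; now rewrite IH.
Qed.

Lemma mult_lt_cnt (h : nat -> R) (d i : nat) :
  (i < d)%nat -> (mult h i < cnt (h i) (map h (seq 0 d)))%nat.
Proof.
intros Hi. rewrite mult_cnt.
replace d with (i + S (d - S i))%nat by lia.
rewrite seq_app, map_app, cnt_app. unfold cnt at 3. simpl.
destruct (Req_EM_T (h i) (h i)); [simpl; lia|lra].
Qed.

Lemma in_P_jet (d : nat) (h : nat -> R) (p : R -> R) :
  in_P d h p ->
  exists F, jet F /\ ker (map h (seq 0 d)) F /\ forall t, p t = F 0%nat t.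
Proof.
intros [c Hc].
exists (fun n t => sumR d (fun i => c i * mono_exp (h i) (mult h i) n t)).
assert (G : forall e, (e <= d)%nat ->
  jet (fun n t => sumR e (fun i => c i * mono_exp (h i) (mult h i) n t)) /\
  ker (map h (seq 0 d)) (fun n t => sumR e (fun i => c i * mono_exp (h i) (mult h i) n t))).
{ induction e as [|e IH]; intros He.
  - split; [intros n t; apply derivable_pt_lim_const|].
    intros n t. unfold sumR. simpl.
    rewrite (Op_ext _ _ (fun n t => 0 * mono_exp 0 0 n t + 0 * mono_exp 0 0 n t))
      by (intros; ring). rewrite Op_lin. ring.
  - destruct IH as [J K]; [lia|].
    assert (E : forall n t, sumR (S e) (fun i => c i * mono_exp (h i) (mult h i) n t) =
      1 * sumR e (fun i => c i * mono_exp (h i) (mult h i) n t)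
      + c e * mono_exp (h e) (mult h e) n t) by (intros; rewrite sumR_S; ring).
    split.
    + intros n t. rewrite (E (S n) t).
      eapply derivable_pt_lim_ext; [intros x; symmetry; apply E|].
      apply (jet_lin _ _ 1 (c e) J (jet_mono_exp _ _)).
    + intros n t. rewrite (Op_ext _ _ _ E). apply ker_lin; [exact K|].
      apply ker_mono_exp, mult_lt_cnt. lia. }
destruct (G d (le_n d)) as [J K]. split; [exact J|]. split; [exact K|]. exact Hc.
Qed.

(** The interpolant I takes the part of Q when the head exponent is raised, and the part of P in the
    induction. It may exceed 1 between the nodes, which is why P is controlled at the nodes only. *)
Lemma comparison (l : list R) (m k : nat) (nu : nat -> R) (P Q : nat -> R -> R) :
  (forall a, In a l -> 0 < a <= 1) ->
  jet P -> jet Q -> ker (l ++ repeat 1 m) P -> ker (repeat 1 (length l + m)) Q ->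
  nu 0%nat = 0 -> incr (length l + m) nu ->
  (forall i, (i < length l + m)%nat -> Rabs (P 0%nat (nu i)) <= 1) ->
  (forall i, (i < length l + m)%nat -> 1 <= - (-1) ^ i * Q 0%nat (nu i)) ->
  Rabs (P (S k) 0) <= Rabs (Q (S k) 0).
Proof.
revert m P. induction l as [|a l IH]; intros m P Hl JP JQ KP KQ H0 Hnu HP HQ.
- simpl in *. destruct m as [|m].
  + rewrite (KP (S k) 0 : P (S k) 0 = 0), Rabs_R0. apply Rabs_pos.
  (* With all exponents equal to 1 the case a = b is still needed, since Q may exceed 1 in modulus
     at the nodes. *)
  + apply (exponent_increase (repeat 1 m) 1 1 k nu P Q); try assumption; try lra.
    * intros c Hc. apply repeat_spec in Hc. lra.
    * now rewrite repeat_length.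
    * intros i Hi. rewrite repeat_length in Hi. apply HP. lia.
    * intros i Hi. rewrite repeat_length in Hi. apply HQ. lia.
- assert (Ll : length (l ++ repeat 1 m) = (length l + m)%nat)
    by now rewrite length_app, repeat_length.
  destruct (interpolation (1 :: l ++ repeat 1 m) nu (fun i => - (-1) ^ i)) as (I & JI & KI & EI).
  { simpl. now rewrite Ll. }
  simpl length in EI. rewrite Ll in EI.
  apply Rle_trans with (Rabs (I (S k) 0)).
  + apply (exponent_increase (l ++ repeat 1 m) a 1 k nu P I); try assumption.
    * apply Hl. now left.
    * apply Hl. now left.
    * intros c Hc. apply in_app_or in Hc. destruct Hc as [Hc|Hc].
      -- apply Hl. now right.
      -- apply repeat_spec in Hc. lra.
    * now rewrite Ll.
    * rewrite Ll. intros i Hi. apply HP. simpl. lia.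
    * rewrite Ll. intros i Hi. rewrite EI by lia.
      pose proof (pow_m1_sqr i). lra.
  + apply (IH (S m) I); try assumption.
    * intros b Hb. apply Hl. now right.
    * intros n t. rewrite <- (KI n t). apply Op_perm. simpl.
      symmetry. apply Permutation_middle.
    * rewrite Nat.add_succ_r. exact KQ.
    * rewrite Nat.add_succ_r. exact Hnu.
    * intros i Hi. rewrite EI by lia. rewrite Rabs_Ropp, pow_1_abs. lra.
    * intros i Hi. apply HQ. simpl. lia.
Qed.

Lemma jet_translate (F : nat -> R -> R) (s : R) : jet F -> jet (fun n t => F n (t + s)).
Proof.
intros HF n t. replace (F (S n) (t + s)) with (F (S n) (t + s) * 1) by ring.
apply (derivable_pt_lim_comp (fun t => t + s) (F n)); [|apply HF].
replace 1 with (1 + 0) by ring.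
apply (derivable_pt_lim_plus id (fun _ => s)).
- apply derivable_pt_lim_id.
- apply derivable_pt_lim_const.
Qed.

Lemma ker_translate (l : list R) (F : nat -> R -> R) (s : R) :
  ker l F -> ker l (fun n t => F n (t + s)).
Proof.
intros HF n t. rewrite <- (HF n (t + s)). clear HF.
revert F n. induction l as [|a l IH]; intros F n; simpl; [reflexivity|].
apply (IH (fun n t => F (S n) t + a * F n t)).
Qed.

Lemma nth_deriv_jet (k : nat) (F : nat -> R -> R) (f g : R -> R) :
  jet F -> (forall t, f t = F 0%nat t) -> nth_deriv k f g -> forall t, g t = F k t.
Proof.
revert F f. induction k as [|k IH]; intros F f HF Hf Hg t; simpl in Hg.
- now rewrite Hg.
- destruct Hg as (f' & Hf' & Hg).
  apply (IH (fun n => F (S n)) f'); [now intros n u; apply HF| |exact Hg].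
  intros u. apply (uniqueness_limite f u); [apply Hf'|].
  apply (derivable_pt_lim_ext (F 0%nat)); [now intros; rewrite Hf|apply HF].
Qed.

Lemma jet_nth_deriv (k : nat) (F : nat -> R -> R) : jet F -> nth_deriv k (F 0%nat) (F k).
Proof.
revert F. induction k as [|k IH]; intros F HF; simpl; [reflexivity|].
exists (F 1%nat). split; [apply HF|]. apply (IH (fun n => F (S n))). intros n t; apply HF.
Qed.

(** * Polynomials times exp(-t) and the Chebyshev polynomial *)

Definition expoly (d : nat) (c : nat -> R) (t : R) : R :=
  exp (- t) * sumR d (fun i => c i * t ^ i).

Definition coef_deriv (c : nat -> R) (i : nat) : R := INR (S i) * c (S i).

Fixpoint expoly_jet (d : nat) (c : nat -> R) (n : nat) (t : R) : R :=
  match n with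
  | O => expoly d c t
  | S n' => expoly_jet (pred d) (coef_deriv c) n' t - expoly_jet d c n' t
  end.

Lemma sumR_0 (f : nat -> R) : sumR 0 f = 0.
Proof. reflexivity. Qed.

Lemma derivable_poly (d : nat) (c : nat -> R) (t : R) :
  derivable_pt_lim (fun t => sumR d (fun i => c i * t ^ i)) t
    (sumR (pred d) (fun i => coef_deriv c i * t ^ i)).
Proof.
induction d as [|d IH]; [apply derivable_pt_lim_const|].
apply (derivable_pt_lim_ext (fun t => sumR d (fun i => c i * t ^ i) + c d * t ^ d)).
{ intros x. now rewrite sumR_S. }
replace (sumR (pred (S d)) (fun i => coef_deriv c i * t ^ i)) with
  (sumR (pred d) (fun i => coef_deriv c i * t ^ i) + c d * (INR d * t ^ pred d)).
- apply derivable_pt_lim_plus; [exact IH|].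
  apply derivable_pt_lim_scal, derivable_pt_lim_pow.
- destruct d as [|d]; [unfold sumR; simpl; ring|].
  simpl pred. rewrite (sumR_S d). unfold coef_deriv at 3. ring.
Qed.

Lemma derivable_expoly (d : nat) (c : nat -> R) (t : R) :
  derivable_pt_lim (expoly d c) t (expoly (pred d) (coef_deriv c) t - expoly d c t).
Proof.
unfold expoly at 2 3.
replace (exp (- t) * sumR (pred d) (fun i => coef_deriv c i * t ^ i) -
   exp (- t) * sumR d (fun i => c i * t ^ i)) with
  ((-1 * exp (-1 * t)) * sumR d (fun i => c i * t ^ i) +
   exp (-1 * t) * sumR (pred d) (fun i => coef_deriv c i * t ^ i))
  by (replace (-1 * t) with (- t) by ring; ring).
apply (derivable_pt_lim_ext (fun t => exp (-1 * t) * sumR d (fun i => c i * t ^ i))).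
{ intros x. unfold expoly. do 2 f_equal. ring. }
apply (derivable_pt_lim_mult (fun t => exp (-1 * t)));
  [apply derivable_pt_lim_exp_lin|apply derivable_poly].
Qed.

Lemma jet_expoly (d : nat) (c : nat -> R) : jet (expoly_jet d c).
Proof.
intros n. revert d c. induction n as [|n IH]; intros d c t; [apply derivable_expoly|].
apply (derivable_pt_lim_minus (expoly_jet (pred d) (coef_deriv c) n) (expoly_jet d c n));
  apply IH.
Qed.

Lemma expoly_jet_0 (c : nat -> R) (n : nat) (t : R) : expoly_jet 0 c n t = 0.
Proof.
revert c. induction n as [|n IH]; intros c; simpl; [|rewrite !IH; ring].
unfold expoly. rewrite sumR_0. ring.
Qed.

(** On e^{-t} p the factor D + 1 acts as differentiation of p, which lowers the number of
    coefficients by one. *)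
Lemma ker_expoly (d : nat) (c : nat -> R) : ker (repeat 1 d) (expoly_jet d c).
Proof.
revert c. induction d as [|d IH]; intros c n t; [apply expoly_jet_0|].
rewrite <- (IH (coef_deriv c) n t). simpl. apply Op_ext. intros; simpl; ring.
Qed.

Lemma decays_expoly_jet (d : nat) (c : nat -> R) (n : nat) : decays (expoly_jet d c n).
Proof.
apply ker_decays with (repeat 1 d); [|apply jet_expoly|apply ker_expoly].
intros a Ha. apply repeat_spec in Ha. lra.
Qed.

Lemma decays_expoly (d : nat) (c : nat -> R) : decays (expoly d c).
Proof. exact (decays_expoly_jet d c 0). Qed.

Lemma expoly_lin (d : nat) (c c' : nat -> R) (al be t : R) :
  expoly d (fun i => al * c i + be * c' i) t = al * expoly d c t + be * expoly d c' t.
Proof.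
unfold expoly.
rewrite (sumR_ext d _ (fun i => al * (c i * t ^ i) + be * (c' i * t ^ i))) by (intros; ring).
rewrite sumR_plus, !sumR_scal. ring.
Qed.

Lemma basis_fun_evec (i : nat) (t : R) : basis_fun evec i t = t ^ i * exp (- t).
Proof.
unfold basis_fun. f_equal.
- f_equal. rewrite mult_cnt. unfold evec, cnt.
  transitivity (length (map (fun _ : nat => 1) (seq 0 i)));
    [|now rewrite length_map, length_seq].
  generalize (seq 0 i). intros s. induction s as [|j s IH]; [reflexivity|].
  simpl in *. destruct (Req_EM_T 1 1); [simpl; now rewrite IH|lra].
- f_equal. unfold evec. ring.
Qed.

Lemma in_P_evec (d : nat) (p : R -> R) :
  in_P d evec p <-> exists c, forall t, p t = expoly d c t.
Proof.
split; intros [c Hc]; exists c; intros t; rewrite Hc; unfold expoly; rewrite <- sumR_scal;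
  apply sumR_ext; intros i _; rewrite basis_fun_evec; ring.
Qed.

Lemma map_evec (d : nat) : map evec (seq 0 d) = repeat 1 d.
Proof.
generalize 0%nat. induction d as [|d IH]; intros n; simpl; [reflexivity|]. now rewrite IH.
Qed.

Lemma expoly_no_walt (d : nat) (s : R) (x : nat -> R) (c : nat -> R) :
  ~ walt (S d) s x (expoly d c).
Proof.
rewrite <- (repeat_length 1 d) at 1.
exact (ker_no_walt _ s x _ (jet_expoly d c) (ker_expoly d c)).
Qed.

(** In the manner of Descartes' rule: [c 0] is the value at 0, and with the wrong sign the point 0
    could be prepended, giving one alternation too many. The factor D + 1 then passes to the
    coefficients of p', with one point less. *)
Lemma walt_coef_sign (d : nat) (s : R) (x : nat -> R) (c : nat -> R) :
  walt (S d) s x (expoly (S d) c) -> 0 <= x 0%nat ->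
  (forall i, (i <= d)%nat -> 0 <= s * (-1) ^ i * c i) /\ c d <> 0.
Proof.
assert (E0 : forall d c, expoly (S d) c 0 = c 0%nat).
{ clear. intros d c. unfold expoly. rewrite sumR_split_first.
  rewrite (sumR_ext d _ (fun i => 0 * c (S i))) by (intros; simpl; ring).
  rewrite sumR_scal, Ropp_0, exp_0. simpl; ring. }
revert s x c. induction d as [|d IH]; intros s x c Hw Hx.
- destruct Hw as (Hs & _ & Hw & i & Hi & Hn).
  assert (i = 0%nat) by lia; subst i. specialize (Hw 0%nat Hi).
  unfold expoly, sumR in Hw, Hn. simpl in Hw, Hn. pose proof (exp_pos (- x 0%nat)). split.
  + intros i Hi'. assert (i = 0%nat) by lia; subst i. simpl. nra.
  + intros E. apply Hn. rewrite E. ring.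
- assert (H0 : 0 <= s * c 0%nat).
  { destruct (Rle_lt_dec 0 (s * c 0%nat)) as [|Hneg]; [assumption|exfalso].
    rewrite <- (E0 (S d) c) in Hneg. destruct Hx as [Hx|Hx].
    - apply (expoly_no_walt (S (S d)) (- s) (prepend 0 x) c).
      apply walt_prepend; [exact Hx|lra|exact Hw].
    - destruct Hw as (_ & _ & Hw & _). specialize (Hw 0%nat ltac:(lia)).
      rewrite <- Hx in Hw. simpl in Hw. lra. }
  destruct (walt_step 1 (expoly (S (S d)) c) (expoly_jet (S (S d)) c 1) d s x
    (jet_expoly _ c 0%nat) Hw) as (y & Hy & Wy).
  apply (walt_ext _ _ _ _ (expoly (S d) (coef_deriv c))) in Wy; [|intros; simpl; ring].
  destruct (IH _ _ _ Wy ltac:(lra)) as [Sg Nz]. split.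
  + intros [|i] Hi; [simpl; lra|]. specialize (Sg i ltac:(lia)). unfold coef_deriv in Sg.
    pose proof (lt_0_INR (S i) ltac:(lia)). simpl pow.
    assert (INR (S i) * (- s * (-1) ^ i * c (S i)) >= 0) by lra. nra.
  + intros E. apply Nz. unfold coef_deriv. rewrite E. ring.
Qed.

(** Inverts [ker_expoly]: the polynomial belonging to (D + 1) F is integrated term by term, and the
    integration constant is a multiple of e^{-t}. *)
Lemma ker_repeat_expoly (d : nat) (F : nat -> R -> R) :
  jet F -> ker (repeat 1 d) F -> exists c, forall t, F 0%nat t = expoly d c t.
Proof.
revert F. induction d as [|d IH]; intros F HF HK.
- exists (fun _ => 0). intros t. rewrite (HK 0%nat t : F 0%nat t = 0).
  unfold expoly. rewrite sumR_0. ring.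
- destruct (IH _ (jet_step 1 F HF) HK) as [c Hc]. cbv beta in Hc.
  set (c' := fun i => match i with O => 0 | S j => c j / INR (S j) end).
  assert (E : forall i, coef_deriv c' i = c i).
  { intros i. unfold coef_deriv, c'. field. apply not_0_INR. lia. }
  set (G := fun n t => 1 * F n t + (- 1) * expoly_jet (S d) c' n t).
  assert (JG : jet G) by (apply jet_lin; [assumption|apply jet_expoly]).
  assert (Z : forall t, G 1%nat t + 1 * G 0%nat t = 0).
  { intros t. unfold G. specialize (Hc t). simpl expoly_jet.
    assert (Eq : expoly d (coef_deriv c') t = expoly d c t).
    { unfold expoly. f_equal. apply sumR_ext. intros. now rewrite E. }
    lra. }
  set (g := G 0%nat 0).
  exists (fun i => 1 * c' i + g * (match i with O => 1 | S _ => 0 end)). intros t.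
  rewrite expoly_lin. unfold expoly at 2. rewrite sumR_split_first.
  rewrite (sumR_ext d _ (fun i => 0 * t ^ i)) by (intros; simpl; ring).
  rewrite sumR_scal.
  assert (Ex : G 0%nat t = exp (- t) * g).
  { unfold g. replace (- t) with (1 * (0 - t)) by ring. apply exp_ode.
    intros z. replace (- (1) * G 0%nat z) with (G 1%nat z) by (specialize (Z z); lra). apply JG. }
  unfold G in Ex. simpl in Ex. simpl. lra.
Qed.

Lemma expoly_interpolation (d : nat) (x v : nat -> R) :
  incr d x -> exists c, forall i, (i < d)%nat -> expoly d c (x i) = v i.
Proof.
intros Hx. destruct (interpolation (repeat 1 d) x v) as (F & JF & KF & EF).
{ now rewrite repeat_length. }
destruct (ker_repeat_expoly d F JF KF) as [c Hc]. exists c.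
intros i Hi. rewrite <- Hc. apply EF. now rewrite repeat_length.
Qed.

(** * Sequential compactness and limits *)

Lemma CV_subseq (u : nat -> R) (phi : nat -> nat) (l : R) :
  (forall n, (n <= phi n)%nat) -> Un_cv u l -> Un_cv (fun n => u (phi n)) l.
Proof.
intros Hphi Hu eps Heps. destruct (Hu eps Heps) as [N HN]. exists N.
intros n Hn. apply HN. specialize (Hphi n). lia.
Qed.

(** The condition n <= phi n stands in for monotonicity: it preserves limits and is stable under
    composition. *)
Lemma bounded_subseq (u : nat -> R) (B : R) :
  (forall n, Rabs (u n) <= B) ->
  exists phi l, (forall n, (n <= phi n)%nat) /\ Un_cv (fun n => u (phi n)) l.
Proof.
intros HB.
destruct (Bolzano_Weierstrass u (fun c => - B <= c <= B) (compact_P3 (- B) B)) as [l Hl].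
{ intros n. specialize (HB n). pose proof (Rle_abs (u n)). pose proof (Rle_abs (- u n)).
  rewrite Rabs_Ropp in *. lra. }
assert (Hp : forall n, exists p, (n <= p)%nat /\ Rabs (u p - l) < / INR (S n)).
{ intros n. assert (Pn : 0 < / INR (S n)) by (apply Rinv_0_lt_compat, lt_0_INR; lia).
  destruct (Hl (disc l (mkposreal _ Pn)) n) as (p & Hp & Vp).
  { exists (mkposreal _ Pn). now intros y Hy. }
  exists p. split; [exact Hp|exact Vp]. }
destruct (functional_choice _ Hp) as [phi Hphi].
exists phi, l. split; [intros n; apply Hphi|].
intros eps Heps. destruct (archimed_cor1 eps Heps) as (N & HN & HN0).
exists N. intros n Hn. unfold Rdist. apply Rlt_trans with (/ INR (S n)); [apply Hphi|].
apply Rle_lt_trans with (/ INR N); [|exact HN].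
apply Rinv_le_contravar; [apply lt_0_INR; lia|apply le_INR; lia].
Qed.

Lemma bounded_subseq_vec (d : nat) (u : nat -> nat -> R) (B : R) :
  (forall n i, (i < d)%nat -> Rabs (u n i) <= B) ->
  exists phi l, (forall n, (n <= phi n)%nat) /\
    forall i, (i < d)%nat -> Un_cv (fun n => u (phi n) i) (l i).
Proof.
induction d as [|d IH]; intros HB.
- exists (fun n => n), (fun _ => 0). split; intros; lia.
- destruct IH as (phi & l & Hphi & Hl); [intros; apply HB; lia|].
  destruct (bounded_subseq (fun n => u (phi n) d) B) as (psi & z & Hpsi & Hz);
    [intros; apply HB; lia|].
  exists (fun n => phi (psi n)), (fun i => if Nat.eq_dec i d then z else l i). split.
  + intros n. specialize (Hpsi n). specialize (Hphi (psi n)). lia.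
  + intros i Hi. destruct (Nat.eq_dec i d) as [->|ne]; [exact Hz|].
    apply (CV_subseq (fun n => u (phi n) i)); [exact Hpsi|apply Hl; lia].
Qed.

Lemma CV_const (c : R) : Un_cv (fun _ => c) c.
Proof. intros eps Heps. exists 0%nat. intros. unfold Rdist. rewrite Rminus_diag. now rewrite Rabs_R0. Qed.

Lemma CV_sumR (d : nat) (u : nat -> nat -> R) (l : nat -> R) :
  (forall i, (i < d)%nat -> Un_cv (fun n => u n i) (l i)) ->
  Un_cv (fun n => sumR d (u n)) (sumR d l).
Proof.
induction d as [|d IH]; intros H; [exact (CV_const 0)|].
rewrite sumR_S. apply Un_cv_ext with (fun n => sumR d (u n) + u n d).
{ intros n. now rewrite sumR_S. }
apply (CV_plus (fun n => sumR d (u n)) (fun n => u n d)); [apply IH; auto with arith|auto with arith].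
Qed.

Lemma CV_pow (u : nat -> R) (l : R) (m : nat) :
  Un_cv u l -> Un_cv (fun n => u n ^ m) (l ^ m).
Proof.
intros H. induction m as [|m IH]; simpl; [apply CV_const|].
now apply (CV_mult u (fun n => u n ^ m)).
Qed.

Lemma CV_expoly (d : nat) (c : nat -> nat -> R) (x : nat -> R) (c0 : nat -> R) (x0 : R) :
  (forall i, (i < d)%nat -> Un_cv (fun n => c n i) (c0 i)) -> Un_cv x x0 ->
  Un_cv (fun n => expoly d (c n) (x n)) (expoly d c0 x0).
Proof.
intros Hc Hx. unfold expoly.
apply (CV_mult (fun n => exp (- x n)) (fun n => sumR d (fun i => c n i * x n ^ i))).
- apply (continuity_seq exp (fun n => - x n)); [apply derivable_continuous_pt, derivable_pt_exp|].
  now apply (CV_opp x).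
- apply (CV_sumR d (fun n i => c n i * x n ^ i)). intros i Hi.
  apply (CV_mult (fun n => c n i) (fun n => x n ^ i)); [now apply Hc|now apply CV_pow].
Qed.

Lemma CV_le (u v : nat -> R) (a b : R) :
  (forall n, u n <= v n) -> Un_cv u a -> Un_cv v b -> a <= b.
Proof.
intros H Ha Hb. destruct (Rle_lt_dec a b) as [|Hlt]; [assumption|exfalso].
destruct (Ha ((a - b) / 2)) as [N1 H1]; [lra|]. destruct (Hb ((a - b) / 2)) as [N2 H2]; [lra|].
specialize (H1 (N1 + N2)%nat ltac:(lia)). specialize (H2 (N1 + N2)%nat ltac:(lia)).
specialize (H (N1 + N2)%nat). unfold Rdist in *.
apply Rabs_def2 in H1. apply Rabs_def2 in H2. lra.
Qed.

Lemma CV_eq (u : nat -> R) (a b : R) : (forall n, u n = b) -> Un_cv u a -> a = b.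
Proof.
intros H Ha. apply (UL_sequence u); [exact Ha|].
apply Un_cv_ext with (fun _ => b); [intros; now rewrite H|apply CV_const].
Qed.

(* The new node replaces a neighbour of the same sign; beyond the ends it may instead be
   added, the node at the other end being dropped. *)
Lemma exchange (d : nat) (f : R -> R) (x : nat -> R) (s : R) :
  incr (S d) x -> 0 <= x 0%nat -> 0 <= s ->
  (forall i, (i <= d)%nat -> f (x i) = (-1) ^ i) -> 1 < Rabs (f s) ->
  exists y e, incr (S d) y /\ 0 <= y 0%nat /\ (e = 1 \/ e = -1) /\
    (forall i, (i <= d)%nat -> 1 <= e * (-1) ^ i * f (y i)) /\
    exists i, (i <= d)%nat /\ 1 < e * (-1) ^ i * f (y i).
Proof.
intros Hx Hx0 Hs Hf Habs.
assert (Sq : forall i, (i <= d)%nat -> (-1) ^ i * f (x i) = 1)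
  by (intros; rewrite Hf by assumption; apply pow_m1_sqr).
assert (Sg : forall i, 1 < (-1) ^ i * f s \/ 1 < - (-1) ^ i * f s).
{ intros i. assert (E : Rabs ((-1) ^ i * f s) = Rabs (f s))
    by (rewrite Rabs_mult, pow_1_abs; ring).
  rewrite <- E in Habs. destruct (Rle_lt_dec 0 ((-1) ^ i * f s)).
  - rewrite Rabs_right in Habs by lra. lra.
  - rewrite Rabs_left in Habs by lra. lra. }
assert (Ns : forall i, (i <= d)%nat -> s <> x i).
{ intros i Hi E. rewrite E, Hf, pow_1_abs in Habs by assumption. lra. }
assert (Replace : forall j, (j <= d)%nat -> 1 < (-1) ^ j * f s ->
  (forall i, (S i = j)%nat -> x i < s) -> ((j < d)%nat -> s < x (S j)) ->
  exists y e, incr (S d) y /\ 0 <= y 0%nat /\ (e = 1 \/ e = -1) /\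
    (forall i, (i <= d)%nat -> 1 <= e * (-1) ^ i * f (y i)) /\
    exists i, (i <= d)%nat /\ 1 < e * (-1) ^ i * f (y i)).
{ intros j Hj Hsj Hl Hr. exists (fun i => if Nat.eq_dec i j then s else x i), 1.
  split; [|split; [|split; [now left|split]]].
  - intros i Hi. destruct (Nat.eq_dec i j) as [E|n1]; destruct (Nat.eq_dec (S i) j) as [E'|n2];
      [lia|subst i; apply Hr; lia|auto|auto].
  - destruct (Nat.eq_dec 0 j); assumption.
  - intros i Hi. destruct (Nat.eq_dec i j) as [->|n1]; [lra|]. rewrite Rmult_1_l, Sq by lia. lra.
  - exists j. split; [exact Hj|]. destruct (Nat.eq_dec j j); [lra|lia]. }
assert (Pos : (s < x 0%nat) \/
  exists j, (j <= d)%nat /\ x j < s /\ ((j < d)%nat -> s < x (S j))).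
{ assert (G : forall m, (m <= d)%nat -> s < x 0%nat \/
    (exists j, (j < m)%nat /\ x j < s /\ s < x (S j)) \/ x m < s).
  { induction m as [|m IH]; intros Hm.
    - specialize (Ns 0%nat ltac:(lia)). destruct (Rtotal_order s (x 0%nat)) as [|[|]]; lra.
    - destruct (IH ltac:(lia)) as [H|[(j & Hj & H1 & H2)|H]]; [now left| |].
      + right; left. exists j. split; [lia|now split].
      + specialize (Ns (S m) Hm). destruct (Rtotal_order s (x (S m))) as [H'|[H'|H']].
        * right; left. exists m. split; [lia|now split].
        * contradiction.
        * right; now right. }
  destruct (G d ltac:(lia)) as [H|[(j & Hj & H1 & H2)|H]]; [now left| |].
  - right. exists j. split; [lia|now split].
  - right. exists d. split; [lia|]. split; [exact H|lia]. }
destruct Pos as [H|(j & Hj & H1 & H2)].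
- destruct (Sg 0%nat) as [S0|S0].
  + apply (Replace 0%nat); [lia|exact S0|intros; lia|].
    intros Hd. apply Rlt_trans with (x 0%nat); [exact H|apply Hx; lia].
  (* Only the first d + 1 entries count, so the last old node drops out; the index shift turns the
     sign into e = -1. *)
  + exists (prepend s x), (-1). split; [|split; [exact Hs|split; [now right|split]]].
    * intros [|i] Hi; simpl; [exact H|apply Hx; lia].
    * intros [|i] Hi; simpl; [simpl in S0; lra|]. specialize (Sq i ltac:(lia)). lra.
    * exists 0%nat. split; [lia|]. simpl in *. lra.
- destruct (Sg j) as [Sj|Sj].
  + apply (Replace j); [exact Hj|exact Sj| |exact H2].
    intros i Hi. apply Rlt_trans with (x j); [rewrite <- Hi; apply Hx; lia|exact H1].
  + destruct (Nat.eq_dec j d) as [->|ne].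
    * exists (fun i => if Nat.eq_dec i d then s else x (S i)), (-1).
      split; [|split; [|split; [now right|split]]].
      -- intros i Hi. destruct (Nat.eq_dec i d); [lia|].
         destruct (Nat.eq_dec (S i) d) as [E|n2]; [rewrite E; exact H1|apply Hx; lia].
      -- destruct (Nat.eq_dec 0 d); [exact Hs|]. apply Rlt_le, Rle_lt_trans with (x 0%nat);
           [exact Hx0|apply Hx; lia].
      -- intros i Hi. destruct (Nat.eq_dec i d) as [->|n1]; [lra|].
         specialize (Sq (S i) ltac:(lia)). simpl in Sq. lra.
      -- exists d. split; [lia|]. destruct (Nat.eq_dec d d); [lra|lia].
    * apply (Replace (S j)); [lia|simpl; lra| |].
      -- intros i Hi. injection Hi as ->. exact H1.
      -- intros Hd. apply Rlt_trans with (x (S j)); [apply H2; lia|apply Hx; lia].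
Qed.

(** * Extremal interpolants and the existence of S_d *)

Definition reference (d : nat) (c x : nat -> R) : Prop :=
  0 <= x 0%nat /\ incr d x /\ forall i, (i < d)%nat -> expoly d c (x i) = (-1) ^ i.

Definition coef_norm (d : nat) (c : nat -> R) : R := sumR d (fun i => Rabs (c i)).

Lemma coef_norm_pos (d : nat) (c : nat -> R) : 0 <= coef_norm d c.
Proof. apply sumR_pos. intros; apply Rabs_pos. Qed.

Lemma coef_norm_ge (d : nat) (c : nat -> R) (i : nat) :
  (i < d)%nat -> Rabs (c i) <= coef_norm d c.
Proof.
unfold coef_norm. induction d as [|d IH]; intros Hi; [lia|]. rewrite sumR_S.
pose proof (coef_norm_pos d c). unfold coef_norm in H. pose proof (Rabs_pos (c d)).
destruct (Nat.eq_dec i d) as [->|]; [lra|]. specialize (IH ltac:(lia)). lra.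
Qed.

Lemma Rabs_expoly_le (d : nat) (c : nat -> R) (B t : R) :
  (forall i, (i < d)%nat -> Rabs (c i) <= B) -> 0 <= t ->
  Rabs (expoly d c t) <= B * expoly d (fun _ => 1) t.
Proof.
intros HB Ht. unfold expoly. pose proof (exp_pos (- t)).
rewrite Rabs_mult, (Rabs_right (exp (- t))) by lra.
replace (B * (exp (- t) * sumR d (fun i => 1 * t ^ i)))
  with (exp (- t) * (B * sumR d (fun i => 1 * t ^ i))) by ring.
apply Rmult_le_compat_l; [lra|].
induction d as [|d IH]; [unfold sumR; simpl; rewrite Rabs_R0; lra|].
rewrite !sumR_S. eapply Rle_trans; [apply Rabs_triang|].
specialize (IH ltac:(auto with arith)). specialize (HB d ltac:(lia)).
rewrite Rabs_mult, (Rabs_right (t ^ d)) by (apply Rle_ge, pow_le; lra).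
pose proof (pow_le t d Ht). nra.
Qed.

(** The norm of the coefficients is minimised because an exchange decreases it strictly. Bounded
    coefficients keep the nodes bounded, as the function has modulus 1 there but decays uniformly;
    nodes cannot merge in the limit, since neighbouring values have opposite signs. *)
Lemma optimal_reference (d : nat) :
  exists c x, reference (S d) c x /\
    forall c' x', reference (S d) c' x' -> coef_norm (S d) c <= coef_norm (S d) c'.
Proof.
(* Norms are negated because [completeness] provides suprema. *)
set (E := fun r => exists c x, reference (S d) c x /\ r = - coef_norm (S d) c).
destruct (completeness E) as [m [Hub Hleast]].
{ exists 0. intros r (c & x & _ & ->). pose proof (coef_norm_pos (S d) c). lra. }
{ destruct (expoly_interpolation (S d) INR (fun i => (-1) ^ i)) as [c Hc].
  { intros i _. apply lt_INR. lia. }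
  exists (- coef_norm (S d) c), c, INR. split; [|reflexivity].
  split; [simpl; lra|]. split; [|exact Hc]. intros i _. apply lt_INR. lia. }
assert (Hseq : forall n, exists cx : (nat -> R) * (nat -> R),
  reference (S d) (fst cx) (snd cx) /\ coef_norm (S d) (fst cx) < - m + / INR (S n)).
{ intros n. assert (Pn : 0 < / INR (S n)) by (apply Rinv_0_lt_compat, lt_0_INR; lia).
  apply NNPP. intros Hno.
  assert (m <= m - / INR (S n)); [|lra]. apply Hleast. intros r (c & x & Hr & ->).
  destruct (Rle_lt_dec (- coef_norm (S d) c) (m - / INR (S n))) as [|Hlt]; [assumption|].
  exfalso. apply Hno. exists (c, x). cbn [fst snd]. split; [exact Hr|lra]. }
destruct (functional_choice _ Hseq) as [cx Hcx].
set (B := - m + 1).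
assert (HB : forall n, coef_norm (S d) (fst (cx n)) <= B).
{ intros n. destruct (Hcx n) as [_ H]. unfold B.
  assert (/ INR (S n) <= / INR 1)
    by (apply Rinv_le_contravar; [simpl; lra|apply le_INR; lia]).
  change (INR 1) with 1 in H0. rewrite Rinv_1 in H0. lra. }
assert (HB0 : 0 <= B) by (eapply Rle_trans; [apply (coef_norm_pos (S d) (fst (cx 0%nat)))|apply HB]).
destruct (decays_expoly (S d) (fun _ => 1) (/ (B + 1))) as [K HK];
  [apply Rinv_0_lt_compat; lra|].
assert (Hnode : forall n i, (i <= d)%nat -> 0 <= snd (cx n) i <= Rmax K 0).
{ intros n i Hi. destruct (Hcx n) as [(H0 & Hi' & Hv) _].
  assert (P : 0 <= snd (cx n) i).
  { destruct i as [|i]; [exact H0|]. left. apply Rle_lt_trans with (snd (cx n) 0%nat); [exact H0|].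
    apply (incr_lt (S d)); [exact Hi'|lia|lia]. }
  split; [exact P|]. destruct (Rle_lt_dec (snd (cx n) i) (Rmax K 0)) as [|Hlt]; [assumption|exfalso].
  pose proof (Rmax_l K 0).
  assert (A := Rabs_expoly_le (S d) (fst (cx n)) B (snd (cx n) i)
    (fun j Hj => Rle_trans _ _ _ (coef_norm_ge _ _ _ Hj) (HB n)) P).
  rewrite Hv, pow_1_abs in A by lia.
  specialize (HK (snd (cx n) i) ltac:(lra)). apply Rabs_def2 in HK.
  assert (B * expoly (S d) (fun _ => 1) (snd (cx n) i) <= B * / (B + 1))
    by (apply Rmult_le_compat_l; lra).
  assert (B * / (B + 1) < 1).
  { apply Rmult_lt_reg_r with (B + 1); [lra|]. rewrite Rmult_assoc, Rinv_l; lra. }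
  lra. }
(* Coefficients and nodes form one vector, so that a single subsequence serves both. *)
destruct (bounded_subseq_vec (S d + S d)
  (fun n i => if lt_dec i (S d) then fst (cx n) i else snd (cx n) (i - S d)%nat)
  (B + Rmax K 0)) as (phi & l & Hphi & Hl).
{ intros n i Hi. pose proof (Rmax_r K 0). destruct (lt_dec i (S d)) as [Hlt|Hge].
  - pose proof (coef_norm_ge _ (fst (cx n)) _ Hlt). specialize (HB n). lra.
  - destruct (Hnode n (i - S d)%nat ltac:(lia)). rewrite Rabs_right; lra. }
set (x := fun i => l (S d + i)%nat).
assert (Hc : forall i, (i < S d)%nat -> Un_cv (fun n => fst (cx (phi n)) i) (l i)).
{ intros i Hi. specialize (Hl i ltac:(lia)). destruct (lt_dec i (S d)); [exact Hl|lia]. }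
assert (Hx : forall i, (i < S d)%nat -> Un_cv (fun n => snd (cx (phi n)) i) (x i)).
{ intros i Hi. specialize (Hl (S d + i)%nat ltac:(lia)).
  destruct (lt_dec (S d + i) (S d)); [lia|].
  replace (S d + i - S d)%nat with i in Hl by lia. exact Hl. }
assert (Hv : forall i, (i < S d)%nat -> expoly (S d) l (x i) = (-1) ^ i).
{ intros i Hi. eapply CV_eq; [|apply (CV_expoly (S d) (fun n => fst (cx (phi n))) _ l (x i) Hc (Hx i Hi))].
  intros n. now apply (Hcx (phi n)). }
exists l, x. split.
- split; [|split; [|exact Hv]].
  + apply (CV_le (fun _ => 0) (fun n => snd (cx (phi n)) 0%nat));
      [|apply CV_const|apply Hx; lia]. intros n. apply Hnode. lia.
  + intros i Hi. assert (Le : x i <= x (S i)).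
    { apply (CV_le (fun n => snd (cx (phi n)) i) (fun n => snd (cx (phi n)) (S i)));
        [|apply Hx; lia|apply Hx; lia].
      intros n. left. apply (Hcx (phi n)). exact Hi. }
    destruct Le as [|E']; [assumption|exfalso].
    assert (V1 := Hv i ltac:(lia)). assert (V2 := Hv (S i) Hi). rewrite <- E', V1 in V2.
    simpl in V2. pose proof (pow_m1_neq0 i). lra.
- intros c' x' Hr. assert (- m <= coef_norm (S d) c').
  { assert (- coef_norm (S d) c' <= m); [|lra]. apply Hub. now exists c', x'. }
  apply Rle_trans with (- m); [|exact H].
  apply (CV_le (fun n => coef_norm (S d) (fst (cx (phi n)))) (fun n => - m + / INR (S n))).
  + intros n. destruct (Hcx (phi n)) as [_ Hlt]. specialize (Hphi n).
    assert (/ INR (S (phi n)) <= / INR (S n))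
      by (apply Rinv_le_contravar; [apply lt_0_INR; lia|apply le_INR; lia]).
    lra.
  + apply (CV_sumR (S d) (fun n i => Rabs (fst (cx (phi n)) i))). intros i Hi.
    apply (cv_cvabs (fun n => fst (cx (phi n)) i)). now apply Hc.
  + intros eps Heps. destruct (archimed_cor1 eps Heps) as (N & HN & HN0). exists N.
    intros n Hn. unfold Rdist. replace (- m + / INR (S n) - - m) with (/ INR (S n)) by ring.
    rewrite Rabs_right by (left; apply Rinv_0_lt_compat, lt_0_INR; lia).
    apply Rle_lt_trans with (/ INR N); [|exact HN].
    apply Rinv_le_contravar; [apply lt_0_INR; lia|apply le_INR; lia].
Qed.

(* After an exchange, both the new interpolant and its difference with the old one alternate
   at the new nodes, so that by [walt_coef_sign] all coefficients shrink in modulus. *)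
Lemma optimal_reference_bounded (d : nat) (c x : nat -> R) :
  reference (S d) c x ->
  (forall c' x', reference (S d) c' x' -> coef_norm (S d) c <= coef_norm (S d) c') ->
  forall t, 0 <= t -> Rabs (expoly (S d) c t) <= 1.
Proof.
intros (Hx0 & Hx & Hv) Hmin t Ht.
destruct (Rle_lt_dec (Rabs (expoly (S d) c t)) 1) as [|Hgt]; [assumption|exfalso].
destruct (exchange d (expoly (S d) c) x t Hx Hx0 Ht ltac:(intros; apply Hv; lia) Hgt)
  as (y & e & Hy & Hy0 & He & Hge & i0 & Hi0 & Hgt0).
assert (Ee : e * e = 1) by (destruct He; subst; ring).
assert (Ne : e <> 0) by (destruct He; subst; lra).
destruct (expoly_interpolation (S d) y (fun i => (-1) ^ i) Hy) as [c' Hc'].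
assert (W1 : walt (S d) 1 y (expoly (S d) c')).
{ repeat split; [lra|exact Hy| |].
  - intros i Hi. rewrite Hc' by exact Hi. pose proof (pow_m1_sqr i). lra.
  - exists 0%nat. split; [lia|]. rewrite Hc' by lia. simpl. lra. }
destruct (walt_coef_sign d 1 y c' W1 Hy0) as [S1 _].
assert (W2 : walt (S d) 1 y (expoly (S d) (fun i => e * c i + (-1) * c' i))).
{ assert (Ev : forall i, (i < S d)%nat -> 1 * (-1) ^ i *
    expoly (S d) (fun i => e * c i + (-1) * c' i) (y i)
    = e * (-1) ^ i * expoly (S d) c (y i) - 1).
  { intros i Hi. rewrite expoly_lin, Hc' by exact Hi. pose proof (pow_m1_sqr i). lra. }
  repeat split; [lra|exact Hy| |].
  - intros i Hi. rewrite Ev by exact Hi. specialize (Hge i ltac:(lia)). lra.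
  - exists i0. split; [lia|]. intros Z. specialize (Ev i0 ltac:(lia)). rewrite Z in Ev. lra. }
destruct (walt_coef_sign d 1 y _ W2 Hy0) as [S2 N2].
(* Both (-1)^i c'_i and (-1)^i (e c_i - c'_i) are nonnegative, so |c'_i| <= |c_i|. [N2] makes this
   strict for the leading coefficient. *)
assert (Key : forall i, (i <= d)%nat ->
  Rabs (c' i) <= Rabs (c i) /\ (Rabs (c' i) = Rabs (c i) -> e * c i + (-1) * c' i = 0)).
{ intros i Hi. specialize (S1 i Hi). specialize (S2 i Hi). cbv beta in S2.
  set (a := (-1) ^ i * c' i). set (b := e * (-1) ^ i * c i).
  assert (A : Rabs (c' i) = a).
  { rewrite <- (Rabs_right a) by (unfold a; lra). unfold a.
    rewrite Rabs_mult, pow_1_abs. ring. }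
  assert (A' : Rabs (c i) = b).
  { rewrite <- (Rabs_right b) by (unfold a, b in *; lra). unfold b.
    rewrite !Rabs_mult, pow_1_abs. destruct He; subst.
    - rewrite Rabs_R1; ring.
    - rewrite (Rabs_left (-1)) by lra. ring. }
  rewrite A, A'. split; [unfold a, b; lra|]. intros Eab.
  assert (Z : (-1) ^ i * (e * c i + -1 * c' i) = 0) by (unfold a, b in Eab; lra).
  apply Rmult_integral in Z. destruct Z as [Z|Z]; [now apply pow_m1_neq0 in Z|exact Z]. }
assert (Hlt : coef_norm (S d) c' < coef_norm (S d) c).
{ unfold coef_norm. rewrite !sumR_S. apply Rplus_le_lt_compat.
  - apply sumR_le. intros i Hi. apply Key. lia.
  - destruct (Key d (le_n d)) as [[Hl|He'] Z]; [exact Hl|]. exfalso. apply N2. now apply Z. }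
specialize (Hmin c' y ltac:(now split)). lra.
Qed.

Lemma interior_max_derivative (f f' : R -> R) (a b y : R) :
  (forall t, derivable_pt_lim f t (f' t)) -> a < y < b ->
  (forall t, a <= t <= b -> f t <= f y) -> f' y = 0.
Proof.
intros Hf Hy Hmax.
assert (pr : derivable_pt f y) by (exists (f' y); apply Hf).
rewrite <- (uniqueness_limite f y _ _ (proj2_sig pr) (Hf y)).
apply (deriv_maximum f a b y pr); [lra|lra|]. intros t H1 H2. apply Hmax. lra.
Qed.

(* A positive first node would be a critical point, to the left of the sign changes of the
   derivative given by [walt_at_infinity]: one sign change too many. *)
Lemma chebyshev_exists (d : nat) :
  exists c nu, nu 0%nat = 0 /\ incr (S d) nu /\
    (forall i, (i <= d)%nat -> expoly (S d) c (nu i) = - (-1) ^ i) /\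
    forall t, 0 <= t -> Rabs (expoly (S d) c t) <= 1.
Proof.
destruct (optimal_reference d) as (c & x & Hr & Hmin).
pose proof (optimal_reference_bounded d c x Hr Hmin) as Hb.
destruct Hr as (Hx0 & Hx & Hv).
(* A [reference] starts with the value +1 but S_d with -1, hence the negation; the zero term fits
   [expoly_lin]. *)
assert (Ht : forall t, expoly (S d) (fun i => (-1) * c i + 0 * c i) t = - expoly (S d) c t)
  by (intros; rewrite expoly_lin; ring).
exists (fun i => (-1) * c i + 0 * c i), x. split; [|split; [exact Hx|split]].
- destruct Hx0 as [Hpos|E]; [exfalso|now symmetry].
  assert (W : walt (S d) 1 x (expoly (S d) c)).
  { repeat split; [lra|exact Hx| |].
    - intros i Hi. rewrite Hv by exact Hi. pose proof (pow_m1_sqr i). lra.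
    - exists 0%nat. split; [lia|]. rewrite Hv by lia. simpl; lra. }
  destruct (walt_at_infinity _ _ d 1 x (jet_expoly (S d) c 0%nat) (decays_expoly _ _) W)
    as (y & Hy & Wy).
  assert (D0 : expoly_jet (S d) c 1 (x 0%nat) = 0).
  { apply (interior_max_derivative (expoly (S d) c) _ 0 (x 0%nat + 1));
      [exact (jet_expoly (S d) c 0%nat)|lra|].
    intros t Ht'. rewrite (Hv 0%nat) by lia. specialize (Hb t ltac:(lra)).
    pose proof (Rle_abs (expoly (S d) c t)). simpl. lra. }
  assert (Wz := walt_prepend _ _ (x 0%nat) y _ Hy ltac:(rewrite D0; lra) Wy).
  pose proof (ker_no_walt (repeat 1 (S d)) (- - (1)) (prepend (x 0%nat) y)
    (fun n => expoly_jet (S d) c (1 + n)%nat)) as No.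
  apply No.
  + apply jet_shift, jet_expoly.
  + intros n t. rewrite (Op_shift _ 1). apply ker_expoly.
  + rewrite repeat_length. exact Wz.
- intros i Hi. rewrite Ht, Hv by lia. reflexivity.
- intros t H0. rewrite Ht, Rabs_Ropp. now apply Hb.
Qed.

(** * The Hermite wave *)

(* The polynomial [sum_j (laguerre n j) x^j] is L_n^(-1/2)(x) / L_n^(-1/2)(0), that is
   H_2n(y) / H_2n(0) with [x = y^2]; the coefficients vanish for [j > n]. *)
Fixpoint laguerre (n j : nat) : R :=
  match j with
  | O => 1
  | S j' => - (INR n - INR j') / (INR (S j') * (INR j' + / 2)) * laguerre n j'
  end.

Lemma laguerre_den_pos (j : nat) : 0 < INR (S j) * (INR j + / 2).
Proof.
apply Rmult_lt_0_compat; [apply lt_0_INR; lia|]. pose proof (pos_INR j). lra.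
Qed.

Lemma laguerre_rec (n j : nat) :
  INR (S j) * (INR j + / 2) * laguerre n (S j) = - (INR n - INR j) * laguerre n j.
Proof.
pose proof (laguerre_den_pos j). cbn [laguerre]. field.
pose proof (pos_INR j). split; [lra|apply not_0_INR; lia].
Qed.

Lemma laguerre_vanish (n j : nat) : (n < j)%nat -> laguerre n j = 0.
Proof.
intros H. induction H as [|j Hj IH]; cbn [laguerre].
- rewrite Rminus_diag. unfold Rdiv. ring.
- rewrite IH. ring.
Qed.

(** In closed form [laguerre n j] is (-n)_j / (j! (1/2)_j), and (-n-1)_j / (-n)_j = (n + 1) / (n + 1
    - j). Clearing the denominator also covers j > n. *)
Lemma laguerre_index_shift (n j : nat) :
  laguerre (S n) j * (INR n + 1 - INR j) = (INR n + 1) * laguerre n j.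
Proof.
induction j as [|j IH]; [simpl; ring|].
pose proof (laguerre_den_pos j) as Hd.
apply Rmult_eq_reg_l with (INR (S j) * (INR j + / 2)); [|lra].
pose proof (laguerre_rec (S n) j) as E1. pose proof (laguerre_rec n j) as E2.
transitivity ((INR (S j) * (INR j + / 2) * laguerre (S n) (S j)) * (INR n + 1 - INR (S j)));
  [ring|].
transitivity ((INR n + 1) * (INR (S j) * (INR j + / 2) * laguerre n (S j))); [|ring].
rewrite E1, E2. rewrite !S_INR.
transitivity (- (INR n - INR j) * (laguerre (S n) j * (INR n + 1 - INR j))); [ring|].
rewrite IH. ring.
Qed.

(** The coefficient of x^{j+1} in p_{n+1} (4n + 2) = 4 x p_n' + (4n + 2 - 4x) p_n. *)
Lemma laguerre_contiguous (n j : nat) :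
  (4 * INR n + 2) * laguerre (S n) (S j) =
  (4 * INR (S j) + 4 * INR n + 2) * laguerre n (S j) - 4 * laguerre n j.
Proof.
pose proof (pos_INR n) as Hn. pose proof (pos_INR j) as Hj.
pose proof (laguerre_den_pos j) as Hd.
pose proof (laguerre_index_shift n j) as E.
apply Rmult_eq_reg_l with ((INR n + 1) * (INR (S j) * (INR j + / 2)));
  [|apply Rmult_integral_contrapositive_currified; lra].
transitivity ((INR n + 1) * (4 * INR n + 2) *
  (INR (S j) * (INR j + / 2) * laguerre (S n) (S j))); [ring|].
transitivity ((4 * INR (S j) + 4 * INR n + 2) *
  ((INR n + 1) * (INR (S j) * (INR j + / 2) * laguerre n (S j))) -
  4 * (INR (S j) * (INR j + / 2)) * ((INR n + 1) * laguerre n j)); [|ring].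
rewrite !laguerre_rec.
transitivity (- (4 * INR (S j) + 4 * INR n + 2) * (INR n - INR j) *
  ((INR n + 1) * laguerre n j) -
  4 * (INR (S j) * (INR j + / 2)) * ((INR n + 1) * laguerre n j)); [|ring].
rewrite <- E, !S_INR. field.
Qed.

Definition poly (d : nat) (c : nat -> R) (t : R) : R := sumR d (fun i => c i * t ^ i).

Lemma poly_S (d : nat) (c : nat -> R) (t : R) : poly (S d) c t = poly d c t + c d * t ^ d.
Proof. unfold poly. now rewrite sumR_S. Qed.

Lemma coef_derivE (c : nat -> R) (i : nat) : coef_deriv c i = INR (S i) * c (S i).
Proof. reflexivity. Qed.

Lemma expoly_jet_1 (d : nat) (c : nat -> R) (t : R) :
  expoly_jet (S d) c 1 t = exp (- t) * (poly d (coef_deriv c) t - poly (S d) c t).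
Proof. simpl. unfold expoly, poly. ring. Qed.

Lemma expoly_jet_2 (d : nat) (c : nat -> R) (t : R) :
  expoly_jet (S d) c 2 t = exp (- t) *
  (poly (pred d) (coef_deriv (coef_deriv c)) t - 2 * poly d (coef_deriv c) t + poly (S d) c t).
Proof. simpl. unfold expoly, poly. ring. Qed.

Lemma poly_second_deriv_S (d : nat) (c : nat -> R) (t : R) :
  t * poly d (coef_deriv (coef_deriv c)) t =
  t * poly (pred d) (coef_deriv (coef_deriv c)) t + INR d * INR (S d) * c (S d) * t ^ d.
Proof.
destruct d as [|d]; [unfold poly, sumR; simpl; ring|].
rewrite poly_S. simpl pred. rewrite !coef_derivE. simpl pow. ring.
Qed.

(** Kummer's equation for a series cut off at degree d: the recursion cancels all powers below t^d.
    Stating the residual lets the induction run over d; it vanishes at d = n. *)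
Lemma confluent_ode_residual (a n : R) (c : nat -> R) (d : nat) (t : R) :
  (forall j, INR (S j) * (INR j + / 2) * c (S j) = - a * (n - INR j) * c j) ->
  t * poly (pred d) (coef_deriv (coef_deriv c)) t
  + (/ 2 - a * t) * poly d (coef_deriv c) t + a * n * poly (S d) c t
  = a * (n - INR d) * c d * t ^ d.
Proof.
intros Hc. induction d as [|d IH]; [unfold poly, sumR; simpl; ring|].
simpl pred. rewrite poly_second_deriv_S, (poly_S d (coef_deriv c)), (poly_S (S d) c).
specialize (Hc d). rewrite coef_derivE. simpl pow.
transitivity ((t * poly (pred d) (coef_deriv (coef_deriv c)) t
  + (/ 2 - a * t) * poly d (coef_deriv c) t + a * n * poly (S d) c t)
  + (INR (S d) * (INR d + / 2) * c (S d)) * t ^ d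
  + a * (n - INR (S d)) * c (S d) * (t * t ^ d)); [ring|].
rewrite IH, Hc. ring.
Qed.

Definition scaled_laguerre (a : R) (n j : nat) : R := a ^ j * laguerre n j.

Lemma scaled_laguerre_ode (a : R) (n : nat) (t : R) :
  t * poly (pred n) (coef_deriv (coef_deriv (scaled_laguerre a n))) t
  + (/ 2 - a * t) * poly n (coef_deriv (scaled_laguerre a n)) t
  + a * INR n * poly (S n) (scaled_laguerre a n) t = 0.
Proof.
rewrite (confluent_ode_residual a (INR n)); [ring|].
intros j. unfold scaled_laguerre. pose proof (laguerre_rec n j) as E. simpl pow.
transitivity (a * a ^ j * (INR (S j) * (INR j + / 2) * laguerre n (S j))); [ring|].
rewrite E. ring.
Qed.

(** The last term again comes from cutting off at degree d, and vanishes for d > n. *)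
Lemma poly_laguerre_raise (n d : nat) (t : R) :
  (4 * INR n + 2) * poly (S d) (laguerre (S n)) t =
  4 * t * poly d (coef_deriv (laguerre n)) t
  + (4 * INR n + 2 - 4 * t) * poly (S d) (laguerre n) t + 4 * laguerre n d * (t * t ^ d).
Proof.
induction d as [|d IH]; [unfold poly, sumR; simpl; ring|].
rewrite (poly_S (S d)), Rmult_plus_distr_l, IH, (poly_S d (coef_deriv _)), (poly_S (S d)).
transitivity (4 * t * poly d (coef_deriv (laguerre n)) t
  + (4 * INR n + 2 - 4 * t) * poly (S d) (laguerre n) t + 4 * laguerre n d * (t * t ^ d)
  + ((4 * INR n + 2) * laguerre (S n) (S d)) * t ^ S d); [ring|].
rewrite laguerre_contiguous, coef_derivE. simpl pow. ring.
Qed.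

Lemma poly_ext (d : nat) (c c' : nat -> R) (t : R) :
  (forall i, c i = c' i) -> poly d c t = poly d c' t.
Proof. intros H. apply sumR_ext. intros. now rewrite H. Qed.

(* In the variable [y] this says that the second derivative of [H_2n(y) e^{-y^2}] is
   [H_{2n+2}(y) e^{-y^2}], up to the normalisation of [laguerre]. *)
Lemma laguerre_raise (n : nat) (x : R) :
  4 * x * expoly_jet (S n) (laguerre n) 2 x + 2 * expoly_jet (S n) (laguerre n) 1 x =
  - (4 * INR n + 2) * expoly (S (S n)) (laguerre (S n)) x.
Proof.
assert (E : forall i, scaled_laguerre 1 n i = laguerre n i)
  by (intros; unfold scaled_laguerre; rewrite pow1; ring).
pose proof (scaled_laguerre_ode 1 n x) as Ode.
rewrite (poly_ext _ _ _ x E) in Ode.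
rewrite (poly_ext n _ (coef_deriv (laguerre n)) x) in Ode
  by (intros; unfold coef_deriv; now rewrite E).
rewrite (poly_ext _ _ (coef_deriv (coef_deriv (laguerre n))) x) in Ode
  by (intros; unfold coef_deriv; now rewrite E).
pose proof (poly_laguerre_raise n (S n) x) as R.
rewrite (laguerre_vanish n (S n)) in R by lia.
rewrite (poly_S n (coef_deriv _)), (poly_S (S n) (laguerre n)) in R.
rewrite coef_derivE, (laguerre_vanish n (S n)) in R by lia.
rewrite expoly_jet_2, expoly_jet_1.
change (expoly (S (S n)) (laguerre (S n)) x) with
  (exp (- x) * poly (S (S n)) (laguerre (S n)) x).
transitivity (exp (- x) * - ((4 * INR n + 2) * poly (S (S n)) (laguerre (S n)) x)); [|ring].
rewrite R. clear R E.
set (P0 := poly (S n) _ x) in *. set (P1 := poly n _ x) in *. set (P2 := poly (pred n) _ x) in *.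
assert (E : x * P2 = - (/ 2 - x) * P1 - INR n * P0) by lra.
transitivity (exp (- x) * (4 * (x * P2) - 8 * x * P1 + 4 * x * P0 + 2 * P1 - 2 * P0)); [ring|].
rewrite E. field.
Qed.

Lemma decays_plus (f g : R -> R) : decays f -> decays g -> decays (fun t => f t + g t).
Proof.
intros Hf Hg eps He.
destruct (Hf (eps / 2)) as [K1 H1]; [lra|]. destruct (Hg (eps / 2)) as [K2 H2]; [lra|].
exists (Rmax K1 K2). intros t Ht. pose proof (Rmax_l K1 K2). pose proof (Rmax_r K1 K2).
specialize (H1 t ltac:(lra)). specialize (H2 t ltac:(lra)).
pose proof (Rabs_triang (f t) (g t)). lra.
Qed.

Lemma decays_le (f g : R -> R) (K0 : R) :
  (forall t, K0 <= t -> Rabs (f t) <= Rabs (g t)) -> decays g -> decays f.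
Proof.
intros H Hg eps He. destruct (Hg eps He) as [K HK]. exists (Rmax K0 K). intros t Ht.
pose proof (Rmax_l K0 K). pose proof (Rmax_r K0 K).
apply Rle_lt_trans with (Rabs (g t)); [apply H; lra|apply HK; lra].
Qed.

Lemma decays_square_arg (f : R -> R) : decays f -> decays (fun y => f (y * y)).
Proof.
intros Hf eps He. destruct (Hf eps He) as [K HK]. exists (Rmax K 1). intros t Ht.
pose proof (Rmax_l K 1). pose proof (Rmax_r K 1). apply HK. nra.
Qed.

Lemma decays_id_mul_expoly (d : nat) (c : nat -> R) : decays (fun x => x * expoly d c x).
Proof.
apply decays_ext with (expoly (S d) (fun i => match i with O => 0 | S j => c j end));
  [|apply decays_expoly].
intros t. unfold expoly. rewrite sumR_split_first, (sumR_ext d _ (fun i => t * (c i * t ^ i)))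
  by (intros; simpl; ring). rewrite sumR_scal. ring.
Qed.

Lemma derivable_square_arg (f f' : R -> R) (y : R) :
  (forall t, derivable_pt_lim f t (f' t)) ->
  derivable_pt_lim (fun y => f (y * y)) y (2 * y * f' (y * y)).
Proof.
intros Hf. rewrite (Rmult_comm (2 * y)).
apply (derivable_pt_lim_comp (fun y => y * y) f); [|apply Hf].
replace (2 * y) with (1 * id y + id y * 1) by (unfold id; ring).
apply (derivable_pt_lim_mult id id); apply derivable_pt_lim_id.
Qed.

(** Induction by two differentiations of F(y) = f(y^2). Neither loses a point, as F and F' decay,
    and F'(0) = 0 adds one in between. By [laguerre_raise] the second derivative is a negative
    multiple of the next function. *)
Lemma laguerre_alternation (n : nat) :
  exists x, 0 <= x 0%nat /\ incr (S n) x /\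
    forall i, (i <= n)%nat -> 0 < (-1) ^ i * expoly (S n) (laguerre n) (x i * x i).
Proof.
induction n as [|n (x & Hx0 & Hx & Hp)].
- exists (fun _ => 0). split; [lra|]. split; [intros i Hi; lia|].
  intros i Hi. assert (i = 0%nat) by lia; subst i. unfold expoly, sumR. simpl.
  pose proof (exp_pos (- (0 * 0))). lra.
- set (J := expoly_jet (S n) (laguerre n)).
  assert (HJ : jet J) by apply jet_expoly.
  set (F := fun y => J 0%nat (y * y)). set (F' := fun y => 2 * y * J 1%nat (y * y)).
  set (F'' := fun y => 2 * J 1%nat (y * y) + 2 * y * (2 * y * J 2%nat (y * y))).
  assert (DF : forall y, derivable_pt_lim F y (F' y))
    by (intros; apply derivable_square_arg, HJ).
  assert (DF' : forall y, derivable_pt_lim F' y (F'' y)).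
  { intros y. unfold F', F''.
    replace (2 * J 1%nat (y * y)) with (2 * 1 * J 1%nat (y * y)) by ring.
    apply (derivable_pt_lim_mult (fun y => 2 * y) (fun y => J 1%nat (y * y))).
    - apply (derivable_pt_lim_scal id), derivable_pt_lim_id.
    - apply derivable_square_arg, HJ. }
  assert (ZF : decays F) by (apply decays_square_arg, decays_expoly_jet).
  assert (ZJ : decays (fun x => x * J 1%nat x)).
  { apply decays_ext with (fun x => x * expoly n (coef_deriv (laguerre n)) x
      + (-1) * (x * expoly (S n) (laguerre n) x)).
    - intros t. unfold J. simpl. ring.
    - apply decays_plus; [|apply decays_scal]; apply decays_id_mul_expoly. }
  assert (ZF' : decays F').
  (* For y >= 1 the factor y is at most y^2, which turns the bound into a function of y^2. *)
  { apply decays_le with (fun y => 2 * (y * y * J 1%nat (y * y))) 1.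
    - intros y Hy. unfold F'. rewrite !Rabs_mult. rewrite (Rabs_right y) by lra.
      pose proof (Rabs_pos (J 1%nat (y * y))). rewrite (Rabs_right 2) by lra.
      assert (0 <= y * (y - 1) * Rabs (J 1%nat (y * y))); [|lra].
      repeat apply Rmult_le_pos; lra.
    - apply decays_scal, (decays_square_arg (fun x => x * J 1%nat x)), ZJ. }
  destruct (alternation_at_infinity F F' n 1 x DF ZF) as (y & Hy & Ay); [lra|exact Hx| |].
  { intros i Hi. specialize (Hp i Hi). unfold F, J. simpl. lra. }
  assert (Nx : forall i, (i <= n)%nat -> F (x i) <> 0).
  { intros i Hi E. specialize (Hp i Hi). unfold F, J in E. simpl in E. rewrite E in Hp. lra. }
  destruct (alternation_at_infinity F' F'' (S n) 1 (prepend 0 y) DF' ZF') as (z & Hz & Az).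
  { lra. }
  { intros [|i] Hi; simpl; [|apply Hy; lia].
    apply Rle_lt_trans with (x 0%nat); [exact Hx0|apply Ay; lia]. }
  { intros [|i] Hi; simpl; [unfold F'; lra|].
    destruct (Ay i ltac:(lia)) as (_ & Sy & _). lra. }
  assert (Pz : forall i, (i <= S n)%nat -> 0 < z i).
  { intros [|i] Hi; destruct (Az _ Hi) as [Lt _]; simpl in Lt; [exact Lt|].
    apply Rlt_trans with (y i); [|exact Lt]. apply Rle_lt_trans with (x i); [|apply Ay; lia].
    destruct i as [|i]; [exact Hx0|]. left. apply Rle_lt_trans with (x 0%nat); [exact Hx0|].
    apply (incr_lt (S n)); [exact Hx|lia|lia]. }
  exists z. split; [left; apply Pz; lia|]. split; [exact Hz|].
  intros i Hi. destruct (Az i Hi) as (_ & Sz & Nz).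
  assert (N : F'' (z i) <> 0).
  { apply Nz. destruct i as [|i].
    - right. split; [lia|]. simpl. apply Ay; [lia|left; apply Nx; lia].
    - left. simpl. apply Ay; [lia|left; apply Nx; lia]. }
  assert (E : F'' (z i) = - (4 * INR n + 2) *
      expoly (S (S n)) (laguerre (S n)) (z i * z i)).
  { rewrite <- laguerre_raise. unfold F'', J. ring. }
  rewrite E in Sz, N. pose proof (pos_INR n).
  set (e := expoly _ _ _) in *.
  assert (e <> 0) by (intros Ee; apply N; rewrite Ee; ring).
  pose proof (Rmult_integral_contrapositive_currified _ _ (pow_m1_neq0 i) H0).
  assert (0 <= (4 * INR n + 2) * ((-1) ^ i * e)) by lra.
  destruct (Rtotal_order ((-1) ^ i * e) 0) as [Hlt|[He|Hgt]]; [nra|contradiction|exact Hgt].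
Qed.

(* [H_2n(sqrt (2 t)) e^{-t} / H_2n(0)] *)
Definition wave (n : nat) : nat -> R -> R := expoly_jet (S n) (scaled_laguerre 2 n).

(** The N in t v'' + v'/2 + (N - t) v = 0, the equation of [wave]: at t = N the coefficient of v
    changes sign. *)
Definition turning (n : nat) : R := 2 * INR n + / 2.

Lemma jet_wave (n : nat) : jet (wave n).
Proof. apply jet_expoly. Qed.

Lemma decays_wave (n : nat) : decays (wave n 0%nat).
Proof. apply decays_expoly. Qed.

Lemma wave_ode (n : nat) (t : R) :
  t * wave n 2 t + wave n 1 t / 2 + (turning n - t) * wave n 0 t = 0.
Proof.
unfold wave, turning. rewrite expoly_jet_2, expoly_jet_1.
change (expoly_jet (S n) (scaled_laguerre 2 n) 0 t) with
  (exp (- t) * poly (S n) (scaled_laguerre 2 n) t).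
rewrite <- (Rmult_0_r (exp (- t))), <- (scaled_laguerre_ode 2 n t). field.
Qed.

Lemma expoly_scaled (d : nat) (c : nat -> R) (a t : R) :
  expoly d (fun i => a ^ i * c i) t = exp (a * t - t) * expoly d c (a * t).
Proof.
unfold expoly. rewrite <- Rmult_assoc, <- exp_plus. f_equal.
- f_equal. ring.
- apply sumR_ext. intros i _. rewrite Rpow_mult_distr. ring.
Qed.

Lemma wave_0 (n : nat) : wave n 0%nat 0 = 1.
Proof.
unfold wave. simpl. unfold expoly. rewrite sumR_split_first.
rewrite (sumR_ext n _ (fun i => 0 * scaled_laguerre 2 n (S i))) by (intros; simpl; ring).
rewrite sumR_scal, Ropp_0, exp_0. unfold scaled_laguerre. simpl; ring.
Qed.

Lemma wave_alternation (n : nat) :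
  exists t, t 0%nat = 0 /\ incr (S n) t /\
    forall i, (i <= n)%nat -> 0 < (-1) ^ i * wave n 0%nat (t i).
Proof.
destruct (laguerre_alternation n) as (x & Hx0 & Hx & Hp).
assert (Px : forall i, (i <= n)%nat -> 0 <= x i).
{ intros [|i] Hi; [exact Hx0|]. left. apply Rle_lt_trans with (x 0%nat); [exact Hx0|].
  apply (incr_lt (S n)); [exact Hx|lia|lia]. }
(* The substitution t = y^2 / 2; the first point is moved to 0, where [wave] equals 1. *)
exists (fun i => match i with O => 0 | S _ => x i * x i / 2 end).
split; [reflexivity|]. split.
- intros i Hi. pose proof (Hx i Hi). pose proof (Px i ltac:(lia)).
  destruct i as [|i]; nra.
- intros [|i] Hi.
  + rewrite wave_0. simpl. lra.
  + unfold wave, scaled_laguerre. cbn [expoly_jet]. rewrite expoly_scaled.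
    replace (2 * (x (S i) * x (S i) / 2)) with (x (S i) * x (S i)) by field.
    specialize (Hp (S i) Hi).
    pose proof (exp_pos (x (S i) * x (S i) - x (S i) * x (S i) / 2)) as He. nra.
Qed.

(* Beyond the turning point [sqrt t * v * v'] is nondecreasing. *)
Lemma wave_beyond_turning (n : nat) (y : R) :
  turning n <= y -> 0 <= wave n 0 y * wave n 1 y -> wave n 0 y = 0.
Proof.
intros Hy Hs. pose proof (pos_INR n) as Hn. unfold turning in Hy.
assert (Mono : forall t, y < t -> 0 <= wave n 0 t * wave n 1 t).
{ intros t Ht.
  set (g' := fun t => / (2 * sqrt t) * (wave n 0 t * wave n 1 t) +
    sqrt t * (wave n 1 t * wave n 1 t + wave n 0 t * wave n 2 t)).
  destruct (MVT_cor2 (fun t => sqrt t * (wave n 0 t * wave n 1 t)) g' y t Ht)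
    as (z & Hz & Hin).
  { intros c Hc.
    apply (derivable_pt_lim_mult sqrt (fun t => wave n 0 t * wave n 1 t)).
    - apply derivable_pt_lim_sqrt. lra.
    - apply (derivable_pt_lim_mult (wave n 0) (wave n 1)); apply jet_wave. }
  assert (Sz : 0 < sqrt z) by (apply sqrt_lt_R0; lra).
  assert (St : 0 < sqrt t) by (apply sqrt_lt_R0; lra).
  assert (Sy : 0 < sqrt y) by (apply sqrt_lt_R0; lra).
  assert (Sq : sqrt z * sqrt z = z) by (apply sqrt_sqrt; lra).
  assert (Gz : 0 <= g' z).
  { assert (E : g' z = sqrt z * (wave n 1 z * wave n 1 z) +
      (z - turning n) / sqrt z * (wave n 0 z * wave n 0 z)).
    { pose proof (wave_ode n z) as Ode. unfold g'.
      apply Rmult_eq_reg_l with (sqrt z); [|lra].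
      transitivity ((sqrt z * sqrt z) * (wave n 1 z * wave n 1 z) +
        wave n 0 z * ((sqrt z * sqrt z) * wave n 2 z + wave n 1 z / 2)); [field; lra|].
      transitivity ((sqrt z * sqrt z) * (wave n 1 z * wave n 1 z) +
        (z - turning n) * (wave n 0 z * wave n 0 z)); [|field; lra].
      rewrite Sq. replace (z * wave n 2 z + wave n 1 z / 2)
        with ((z - turning n) * wave n 0 z) by lra. ring. }
    rewrite E. apply Rplus_le_le_0_compat.
    - apply Rmult_le_pos; [lra|apply Rle_0_sqr].
    - apply Rmult_le_pos; [|apply Rle_0_sqr]. apply Rmult_le_pos; [unfold turning; lra|].
      left; now apply Rinv_0_lt_compat. }
  assert (0 <= sqrt y * (wave n 0 y * wave n 1 y)) by (apply Rmult_le_pos; lra).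
  assert (0 <= g' z * (t - y)) by (apply Rmult_le_pos; lra).
  assert (0 <= sqrt t * (wave n 0 t * wave n 1 t)) by lra. nra. }
(* By [Mono] the square v^2 is nondecreasing beyond y, which contradicts decay if v(y) is
   nonzero. *)
destruct (Req_dec (wave n 0 y) 0) as [|Hnz]; [assumption|exfalso].
destruct (decays_wave n (Rabs (wave n 0%nat y))) as [K HK]; [now apply Rabs_pos_lt|].
set (t := Rmax K (y + 1)). pose proof (Rmax_l K (y + 1)). pose proof (Rmax_r K (y + 1)).
fold t in H, H0. specialize (HK t H).
destruct (MVT_cor2 (fun t => wave n 0 t * wave n 0 t)
  (fun t => wave n 1 t * wave n 0 t + wave n 0 t * wave n 1 t) y t) as (z & Hz & Hin); [lra| |].
{ intros c _. apply (derivable_pt_lim_mult (wave n 0) (wave n 0)); apply jet_wave. }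
specialize (Mono z ltac:(lra)).
apply (Rsqr_lt_abs_1 _ _) in HK. unfold Rsqr in HK.
assert (0 <= (wave n 1 z * wave n 0 z + wave n 0 z * wave n 1 z) * (t - y))
  by (apply Rmult_le_pos; lra).
lra.
Qed.

(** Sonin's function times N - t. By the differential equation its derivative is - v^2, so unlike
    the quotient it is also controlled at the turning point. *)
Definition energy (n : nat) (t : R) : R :=
  (turning n - t) * (wave n 0 t * wave n 0 t) + t * (wave n 1 t * wave n 1 t).

Lemma derivable_energy (n : nat) (t : R) :
  derivable_pt_lim (energy n) t (- (wave n 0 t * wave n 0 t)).
Proof.
pose proof (wave_ode n t) as Ode.
replace (- (wave n 0 t * wave n 0 t)) with
  ((0 - 1) * (wave n 0 t * wave n 0 t) +
   (turning n - t) * (wave n 1 t * wave n 0 t + wave n 0 t * wave n 1 t) +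
   (1 * (wave n 1 t * wave n 1 t) + t * (wave n 2 t * wave n 1 t + wave n 1 t * wave n 2 t))).
- apply (derivable_pt_lim_plus (fun t => (turning n - t) * (wave n 0 t * wave n 0 t))
    (fun t => t * (wave n 1 t * wave n 1 t))).
  + apply (derivable_pt_lim_mult (fun t => turning n - t) (fun t => wave n 0 t * wave n 0 t)).
    * apply (derivable_pt_lim_minus (fun _ => turning n) id);
        [apply derivable_pt_lim_const|apply derivable_pt_lim_id].
    * apply (derivable_pt_lim_mult (wave n 0) (wave n 0)); apply jet_wave.
  + apply (derivable_pt_lim_mult id (fun t => wave n 1 t * wave n 1 t)).
    * apply derivable_pt_lim_id.
    * apply (derivable_pt_lim_mult (wave n 1) (wave n 1)); apply jet_wave.
- transitivity (- (wave n 0 t * wave n 0 t) + 2 * wave n 1 t *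
    (t * wave n 2 t + wave n 1 t / 2 + (turning n - t) * wave n 0 t)); [field|].
  rewrite Ode. ring.
Qed.

Lemma energy_0 (n : nat) : energy n 0 = turning n.
Proof. unfold energy. rewrite wave_0. ring. Qed.

Lemma energy_le (n : nat) (t : R) : 0 <= t -> energy n t <= turning n.
Proof.
intros [Ht|<-]; [|rewrite energy_0; lra].
destruct (MVT_cor2 (energy n) (fun t => - (wave n 0 t * wave n 0 t)) 0 t Ht) as (z & Hz & _).
{ intros; apply derivable_energy. }
rewrite energy_0 in Hz. pose proof (Rle_0_sqr (wave n 0 z)). unfold Rsqr in H.
assert (0 <= wave n 0 z * wave n 0 z * (t - 0)) by (apply Rmult_le_pos; lra). lra.
Qed.

(* Sonin's function [v^2 + t v'^2 / (N - t)] is nondecreasing before the turning point. *)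
Lemma wave_critical_value (n : nat) (y : R) :
  0 < y -> wave n 1 y = 0 -> wave n 0 y <> 0 -> 1 <= wave n 0 y * wave n 0 y.
Proof.
intros Hy H1 H0.
destruct (Rle_lt_dec (turning n) y) as [Hge|Hlt].
{ exfalso. apply H0, wave_beyond_turning; [exact Hge|]. rewrite H1. lra. }
set (g := fun t => turning n - t).
destruct (MVT_cor2 (fun t => energy n t / g t)
  (fun t => (- (wave n 0 t * wave n 0 t) * g t - (0 - 1) * energy n t) / Rsqr (g t)) 0 y Hy)
  as (z & Hz & Hin).
{ intros c Hc. apply (derivable_pt_lim_div (energy n) g c).
  - apply derivable_energy.
  - apply (derivable_pt_lim_minus (fun _ => turning n) id);
      [apply derivable_pt_lim_const|apply derivable_pt_lim_id].
  - unfold g. lra. }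
rewrite energy_0 in Hz.
assert (Gz : 0 < g z) by (unfold g; lra).
assert (P : 0 <= (- (wave n 0 z * wave n 0 z) * g z - (0 - 1) * energy n z) / Rsqr (g z)).
(* The terms in v^2 cancel in the numerator of the derivative of energy / (N - t), leaving t
   v'^2. *)
{ replace (- (wave n 0 z * wave n 0 z) * g z - (0 - 1) * energy n z)
    with (z * (wave n 1 z * wave n 1 z)) by (unfold energy, g; ring).
  apply Rmult_le_pos.
  - apply Rmult_le_pos; [lra|apply Rle_0_sqr].
  - left. apply Rinv_0_lt_compat, Rlt_0_sqr. lra. }
assert (Ey : energy n y / g y = wave n 0 y * wave n 0 y).
{ unfold energy. rewrite H1. unfold g. field. lra. }
assert (E0 : turning n / g 0 = 1) by (unfold g; field; lra).
rewrite Ey, E0 in Hz.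
assert (0 <= (- (wave n 0 z * wave n 0 z) * g z - (0 - 1) * energy n z) / Rsqr (g z) * (y - 0))
  by (apply Rmult_le_pos; lra).
lra.
Qed.

Lemma local_peak (f f' : R -> R) (a b z : R) :
  (forall t, derivable_pt_lim f t (f' t)) -> a < z < b -> f a < f z -> f b < f z ->
  exists y, a < y < b /\ f' y = 0 /\ f z <= f y.
Proof.
intros Hf Hz Ha Hb.
destruct (continuity_ab_maj f a b) as (y & Hmax & Hy); [lra| |].
{ intros c _. apply derivable_continuous_pt. exists (f' c). apply Hf. }
assert (f z <= f y) by (apply Hmax; lra).
assert (a < y < b).
{ destruct (Req_dec y a) as [->|]; [lra|]. destruct (Req_dec y b) as [->|]; lra. }
exists y. split; [assumption|]. split; [|assumption].
now apply (interior_max_derivative f f' a b).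
Qed.

Lemma decays_point (f : R -> R) (z e : R) :
  decays f -> 0 < e -> exists K, z < K /\ Rabs (f K) < e.
Proof.
intros Hf He. destruct (Hf e He) as [K HK]. exists (Rmax K (z + 1)).
pose proof (Rmax_l K (z + 1)). pose proof (Rmax_r K (z + 1)).
split; [lra|]. now apply HK.
Qed.

(** Each new peak is sought between the previous peak and the next alternation point (or a far
    point, for the last one): at both ends (-1)^i v is smaller than at t_i. By [wave_critical_value]
    the peak has modulus at least 1. The first one is the end point 0, with value 1. *)
Lemma wave_peaks (n : nat) :
  exists y, y 0%nat = 0 /\ incr (S n) y /\
    forall i, (i <= n)%nat -> 1 <= (-1) ^ i * wave n 0%nat (y i).
Proof.
destruct (wave_alternation n) as (t & Ht0 & Ht & Hp).
assert (G : forall m, (m <= n)%nat -> exists y, y 0%nat = 0 /\ incr (S m) y /\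
  (forall i, (i <= m)%nat -> 1 <= (-1) ^ i * wave n 0%nat (y i)) /\
  ((m < n)%nat -> y m < t (S m))).
{ induction m as [|m IH]; intros Hm.
  - exists (fun _ => 0). split; [reflexivity|]. split; [intros i Hi; lia|]. split.
    + intros i Hi. assert (i = 0%nat) by lia; subst i. rewrite wave_0. simpl; lra.
    + intros Hn. rewrite <- Ht0. apply Ht. lia.
  - destruct IH as (y & Hy0 & Hy & Hv & Hlast); [lia|]. specialize (Hlast ltac:(lia)).
    set (w := fun x => (-1) ^ S m * wave n 0%nat x).
    set (w' := fun x => (-1) ^ S m * wave n 1%nat x).
    assert (Dw : forall x, derivable_pt_lim w x (w' x))
      by (intros; apply derivable_pt_lim_scal, jet_wave).
    assert (Wz : 0 < w (t (S m))) by (apply Hp; exact Hm).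
    assert (Wy : w (y m) < w (t (S m))).
    { specialize (Hv m (le_n m)). unfold w at 1. simpl. lra. }
    assert (HK : exists K, t (S m) < K /\ w K < w (t (S m)) /\
      ((S m < n)%nat -> K = t (S (S m)))).
    { destruct (lt_dec (S m) n) as [Hlt|Hge].
      - exists (t (S (S m))). split; [apply Ht; lia|]. split; [|reflexivity].
        specialize (Hp (S (S m)) ltac:(lia)). simpl in Hp. unfold w at 1. simpl. lra.
      - destruct (decays_point w (t (S m)) (w (t (S m)))) as (K & HK & HwK).
        + apply decays_scal, decays_wave.
        + exact Wz.
        + exists K. split; [exact HK|]. split; [|intros; lia]. apply Rabs_def2 in HwK. lra. }
    destruct HK as (K & HtK & HwK & HKt).
    destruct (local_peak w w' (y m) K (t (S m)) Dw) as (p & Hpin & Hp0 & Hpv);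
      [lra|exact Wy|exact HwK|].
    assert (Py : 0 <= y m).
    { destruct m as [|m]; [lra|]. left. rewrite <- Hy0.
      apply (incr_lt (S (S m))); [exact Hy|lia|lia]. }
    assert (Vp : 1 <= w p * w p).
    { replace (w p * w p) with (((-1) ^ S m * (-1) ^ S m) * (wave n 0 p * wave n 0 p))
        by (unfold w; ring).
      rewrite pow_m1_sqr, Rmult_1_l. apply wave_critical_value; [lra| |].
      - unfold w' in Hp0. apply Rmult_integral in Hp0.
        destruct Hp0 as [Hp0|Hp0]; [now apply pow_m1_neq0 in Hp0|exact Hp0].
      - intros E. unfold w at 2 in Hpv. rewrite E in Hpv. lra. }
    exists (fun i => if Nat.eq_dec i (S m) then p else y i). split; [exact Hy0|]. split; [|split].
    + intros i Hi. destruct (Nat.eq_dec i (S m)); [lia|].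
      destruct (Nat.eq_dec (S i) (S m)) as [E|ne]; [|apply Hy; lia].
      injection E as ->. lra.
    + intros i Hi. destruct (Nat.eq_dec i (S m)) as [->|ne]; [|apply Hv; lia].
      fold (w p). nra.
    + intros Hn. destruct (Nat.eq_dec (S m) (S m)); [|lia]. rewrite <- HKt by exact Hn. lra. }
destruct (G n (le_n n)) as (y & H1 & H2 & H3 & _). now exists y.
Qed.

(** If u = e^{-delta t} v exceeds 1, u^2 has an interior maximum y, where v' = delta v. Beyond the
    turning point this is excluded; before it, [energy_le] gives v^2 (N - y + y delta^2) <= N, while
    u(y)^2 > 1 means v^2 > e^{2 delta y}. For large N the two are incompatible. *)
Lemma wave_damped (n : nat) (delta s : R) :
  0 < delta -> / delta <= turning n -> 8 <= delta ^ 4 * turning n ^ 2 -> 0 <= s ->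
  Rabs (exp (- delta * s) * wave n 0 s) <= 1.
Proof.
intros Hd N1 N2 Hs.
destruct (Rle_lt_dec (Rabs (exp (- delta * s) * wave n 0 s)) 1) as [|Hgt]; [assumption|exfalso].
set (u := fun t => exp (- delta * t) * wave n 0 t).
set (u' := fun t => - delta * exp (- delta * t) * wave n 0 t + exp (- delta * t) * wave n 1 t).
assert (Du : forall t, derivable_pt_lim u t (u' t)).
{ intros t. apply (derivable_pt_lim_mult (fun t => exp (- delta * t)));
    [apply derivable_pt_lim_exp_lin|apply jet_wave]. }
set (q := fun t => u t * u t).
assert (Dq : forall t, derivable_pt_lim q t (u' t * u t + u t * u' t))
  by (intros; apply (derivable_pt_lim_mult u u); apply Du).
assert (U0 : u 0 = 1) by (unfold u; rewrite Rmult_0_r, exp_0, wave_0; ring).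
fold (u s) in Hgt.
assert (Qs : 1 < q s).
{ unfold q. rewrite <- (Rabs_right (u s * u s)) by apply Rle_ge, Rle_0_sqr.
  rewrite Rabs_mult. nra. }
assert (Hs' : 0 < s).
{ destruct Hs as [|<-]; [assumption|]. unfold q in Qs. rewrite U0 in Qs. lra. }
assert (Zu : decays u).
{ apply decays_le with (wave n 0) 0; [|apply decays_wave]. intros t Ht. unfold u.
  rewrite Rabs_mult, (Rabs_right (exp _)) by (left; apply exp_pos).
  assert (exp (- delta * t) <= 1).
  { rewrite <- exp_0. destruct Ht as [Ht|<-]; [left; apply exp_increasing; nra|].
    rewrite Rmult_0_r. lra. }
  pose proof (Rabs_pos (wave n 0 t)). pose proof (exp_pos (- delta * t)). nra. }
destruct (decays_point u s 1 Zu) as (K & HK & HuK); [lra|].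
destruct (local_peak q _ 0 K s Dq) as (y & Hy & Hy0 & Hyv).
{ lra. }
{ unfold q at 1. rewrite U0. lra. }
{ assert (q K < 1); [|lra]. unfold q. apply Rabs_def2 in HuK. nra. }
set (e := exp (- delta * y)) in *. assert (He : 0 < e) by apply exp_pos.
assert (Uy : u y = e * wave n 0 y) by reflexivity.
assert (Qy : 1 < u y * u y) by (unfold q in Hyv at 2; lra).
assert (Uy0 : u y <> 0) by (intros E; rewrite E in Qy; lra).
assert (V1 : wave n 1 y = delta * wave n 0 y).
{ assert (E : u' y * u y = 0) by lra. apply Rmult_integral in E. destruct E as [E|E]; [|lra].
  unfold u' in E. fold e in E.
  apply Rmult_eq_reg_l with e; lra. }
assert (V0 : wave n 0 y <> 0) by (intros E; apply Uy0; rewrite Uy, E; ring).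
destruct (Rle_lt_dec (turning n) y) as [Hge|Hlt].
{ apply V0, wave_beyond_turning; [exact Hge|]. rewrite V1.
  replace (wave n 0 y * (delta * wave n 0 y)) with (delta * (wave n 0 y * wave n 0 y)) by ring.
  apply Rmult_le_pos; [lra|apply Rle_0_sqr]. }
pose proof (energy_le n y ltac:(lra)) as En. unfold energy in En. rewrite V1 in En.
set (N := turning n) in *. set (v2 := wave n 0 y * wave n 0 y) in *.
assert (En' : v2 * (N - y + y * delta ^ 2) <= N) by (unfold v2 in *; lra).
set (x := exp (delta * y)).
assert (Hx : 1 + delta * y <= x) by apply exp_ineq1_le.
assert (Ex : x * e = 1).
{ unfold x, e. rewrite <- exp_plus. replace (delta * y + - delta * y) with 0 by ring. apply exp_0. }
assert (Hv2 : x * x < v2).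
{ assert (Q1 : 1 < e * e * v2) by (rewrite Uy in Qy; unfold v2; lra).
  replace v2 with (x * x * (e * e * v2)); [|transitivity ((x * e) * (x * e) * v2); [ring|rewrite Ex; ring]].
  assert (0 < x) by apply exp_pos. assert (0 < x * x) by nra. nra. }
assert (Hdy : 0 < delta * y) by nra.
assert (Hpos : 0 < N - y + y * delta ^ 2) by (simpl; nra).
assert (Key : x * x * (N - y + y * delta ^ 2) < N).
{ apply Rlt_le_trans with (v2 * (N - y + y * delta ^ 2)); [|exact En'].
  now apply Rmult_lt_compat_r. }
(* Up to N / 2, e^{2 delta y} >= 1 + 2 delta y and delta N >= 1 suffice. Beyond, e^{2 delta y} >=
   (delta y)^2 and the term y delta^2 give delta^4 y^3 < N, against delta^4 y^2 >= 2; hence the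
   constant 8. *)
destruct (Rle_lt_dec y (N / 2)) as [Hsmall|Hbig].
- assert (1 + 2 * (delta * y) <= x * x) by nra.
  assert (D1 : 1 <= delta * N).
  { apply Rmult_le_compat_l with (r := delta) in N1; [|lra]. rewrite Rinv_r in N1; lra. }
  assert ((1 + 2 * (delta * y)) * (N - y) < N).
  { apply Rle_lt_trans with (x * x * (N - y + y * delta ^ 2)); [|exact Key].
    apply Rmult_le_compat; simpl; nra. }
  nra.
- assert (Hx2 : (delta * y) * (delta * y) <= x * x) by nra.
  assert (A : (delta * y) * (delta * y) * (y * delta ^ 2) < N).
  { apply Rle_lt_trans with (x * x * (N - y + y * delta ^ 2)); [|exact Key].
    apply Rmult_le_compat; simpl; nra. }
  assert (B : delta ^ 4 * (y * y) * y < N) by (simpl in *; lra).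
  assert (HN : 0 < N) by (unfold N, turning; pose proof (pos_INR n); lra).
  assert (C : N ^ 2 / 4 <= y * y) by (simpl; nra).
  assert (D4 : 0 < delta ^ 4) by (apply pow_lt; lra).
  assert (2 <= delta ^ 4 * (y * y)).
  { apply Rle_trans with (delta ^ 4 * (N ^ 2 / 4)); [lra|apply Rmult_le_compat_l; lra]. }
  nra.
Qed.

(** * Conclusion *)

Lemma binom_0_r (n : nat) : binom n 0 = 1%nat.
Proof. now destruct n. Qed.

Lemma binom_gt (n k : nat) : (n < k)%nat -> binom n k = 0%nat.
Proof.
revert k. induction n as [|n IH]; intros [|k] H; [lia|reflexivity|lia|].
simpl. rewrite !IH by lia. reflexivity.
Qed.

Lemma binom_absorb (n k : nat) : (S k * binom (S n) (S k) = S n * binom n k)%nat.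
Proof.
revert k. induction n as [|n IH]; intros k.
- destruct k as [|k]; simpl; [reflexivity|]. lia.
- destruct k as [|k].
  + specialize (IH 0%nat). rewrite binom_0_r in *. change (binom (S (S n)) 1) with
      (binom (S n) 0 + binom (S n) 1)%nat. rewrite binom_0_r. lia.
  + change (binom (S (S n)) (S (S k))) with (binom (S n) (S k) + binom (S n) (S (S k)))%nat.
    pose proof (IH k) as E1. pose proof (IH (S k)) as E2.
    change (binom (S n) (S k)) with (binom n k + binom n (S k))%nat in *. nia.
Qed.

Lemma binom_step (n k : nat) : (S k * binom n (S k) + k * binom n k = n * binom n k)%nat.
Proof.
destruct n as [|n]; [destruct k; simpl; lia|].
destruct k as [|k]; [pose proof (binom_absorb n 0); rewrite !binom_0_r in *; lia|].
pose proof (binom_absorb n (S k)) as E1. pose proof (binom_absorb n k) as E2.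
change (binom (S n) (S k)) with (binom n k + binom n (S k))%nat in *. nia.
Qed.

Lemma binom_central_step (j : nat) :
  (S j * binom (2 * S j) (S j) = 2 * (2 * j + 1) * binom (2 * j) j)%nat.
Proof.
replace (2 * S j)%nat with (S (S (2 * j))) by lia.
pose proof (binom_absorb (S (2 * j)) j) as E1.
pose proof (binom_step (S (2 * j)) j) as E2.
pose proof (binom_absorb (2 * j) j) as E3. nia.
Qed.

Lemma binom_central_pos (j : nat) : 0 < INR (binom (2 * j) j).
Proof.
apply lt_0_INR. induction j as [|j IH]; [apply Nat.lt_0_1|].
pose proof (binom_central_step j) as E. nia.
Qed.

(** The factor 8^j is 2^j from the scaling times 4^j from (1/2)_j = (2j)! / (4^j j!). *)
Lemma scaled_laguerre_binom (n j : nat) :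
  INR (fact j) * scaled_laguerre 2 n j =
  (-1) ^ j * (8 ^ j * INR (binom n j) / INR (binom (2 * j) j)).
Proof.
induction j as [|j IH].
- unfold scaled_laguerre. simpl. rewrite binom_0_r. simpl. field.
- pose proof (binom_central_pos j) as P0. pose proof (binom_central_pos (S j)) as P1.
  pose proof (pos_INR j) as Pj.
  assert (E1 : INR (S j) * INR (binom n (S j)) = (INR n - INR j) * INR (binom n j)).
  { pose proof (f_equal INR (binom_step n j)) as E. rewrite plus_INR, !mult_INR in E. lra. }
  assert (E2 : INR (S j) * INR (binom (2 * S j) (S j)) =
    2 * (2 * INR j + 1) * INR (binom (2 * j) j)).
  { pose proof (f_equal INR (binom_central_step j)) as E.
    rewrite !mult_INR, plus_INR, mult_INR in E. simpl (INR 2) in E. simpl (INR 1) in E. lra. }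
  assert (E3 := laguerre_rec n j).
  assert (Sj : INR (S j) <> 0) by (apply not_0_INR; lia).
  assert (F1 : INR (binom n (S j)) = (INR n - INR j) * INR (binom n j) / INR (S j)).
  { apply Rmult_eq_reg_l with (INR (S j)); [|exact Sj]. rewrite E1. field. exact Sj. }
  assert (F2 : INR (binom (2 * S j) (S j)) =
    2 * (2 * INR j + 1) * INR (binom (2 * j) j) / INR (S j)).
  { apply Rmult_eq_reg_l with (INR (S j)); [|exact Sj]. rewrite E2. field. exact Sj. }
  rewrite F1, F2. unfold scaled_laguerre in *.
  rewrite fact_simpl, mult_INR. cbn [laguerre].
  transitivity (- (INR n - INR j) / (INR j + / 2) * 2 * (INR (fact j) * (2 ^ j * laguerre n j))).
  { simpl pow. field. split; [lra|exact Sj]. }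
  rewrite IH. simpl pow. field. repeat split; try lra; exact Sj.
Qed.

(** Leibniz's rule for e^{-t} p at 0; the exponent k + j replaces k - j to avoid truncated
    subtraction. *)
Lemma expoly_jet_at_0 (k d : nat) (c : nat -> R) :
  (forall j, (d <= j)%nat -> c j = 0) ->
  expoly_jet d c k 0 =
  sumR (S k) (fun j => INR (binom k j) * (-1) ^ (k + j) * (INR (fact j) * c j)).
Proof.
revert d c. induction k as [|k IH]; intros d c Hc.
- unfold sumR. simpl. unfold expoly. rewrite Ropp_0, exp_0.
  destruct d as [|d]; [rewrite Hc by lia; unfold sumR; simpl; ring|].
  rewrite sumR_split_first, (sumR_ext d _ (fun i => 0 * c (S i))) by (intros; simpl; ring).
  rewrite sumR_scal. simpl. ring.
- cbn [expoly_jet]. rewrite (IH (pred d)), (IH d c Hc).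
  2: { intros j Hj. unfold coef_deriv. rewrite Hc by lia. ring. }
  rewrite (sumR_split_first (S k)).
  rewrite (sumR_ext (S k) (fun i => INR (binom (S k) (S i)) * _ * _)
    (fun i => INR (binom k i) * (-1) ^ (k + i) * (INR (fact i) * coef_deriv c i)
      + (-1) * (INR (binom k (S i)) * (-1) ^ (k + S i) * (INR (fact (S i)) * c (S i))))).
  + rewrite sumR_plus, sumR_scal.
    assert (E : sumR (S k) (fun j => INR (binom k j) * (-1) ^ (k + j) * (INR (fact j) * c j)) =
      sumR (S (S k)) (fun j => INR (binom k j) * (-1) ^ (k + j) * (INR (fact j) * c j))).
    { rewrite (sumR_S (S k)), (binom_gt k (S k)) by lia. simpl INR. ring. }
    rewrite E, (sumR_split_first (S k)), !binom_0_r. rewrite !Nat.add_0_r. simpl pow. ring.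
  + intros i _. change (binom (S k) (S i)) with (binom k i + binom k (S i))%nat.
    rewrite plus_INR, fact_simpl, mult_INR. unfold coef_deriv.
    rewrite <- !Nat.add_succ_comm. simpl pow. ring.
Qed.

(** The signs of Leibniz's rule and of the coefficients combine to (-1)^k in every term, so nothing
    cancels. *)
Lemma scaled_wave_derivative_at_0 (lam : R) (k n : nat) :
  expoly_jet (S n) (fun i => lam ^ i * scaled_laguerre 2 n i) k 0 =
  (-1) ^ k * sumR (S k) (fun j => lam ^ j * (8 ^ j * INR (binom (S n - 1) j) * INR (binom k j)
    / INR (binom (2 * j) j))).
Proof.
rewrite expoly_jet_at_0.
- rewrite <- sumR_scal. apply sumR_ext. intros j _.
  replace (S n - 1)%nat with n by lia.
  pose proof (binom_central_pos j).
  transitivity (INR (binom k j) * (-1) ^ (k + j) * lam ^ j *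
    (INR (fact j) * scaled_laguerre 2 n j)); [ring|].
  rewrite scaled_laguerre_binom, pow_add.
  transitivity (((-1) ^ j * (-1) ^ j) * ((-1) ^ k * (lam ^ j * (8 ^ j * INR (binom n j) *
    INR (binom k j) / INR (binom (2 * j) j))))); [field; lra|].
  rewrite pow_m1_sqr. ring.
- intros j Hj. unfold scaled_laguerre. rewrite laguerre_vanish by lia. ring.
Qed.

Lemma RHS_term_pos (k d j : nat) :
  0 <= 8 ^ j * INR (binom (d - 1) j) * INR (binom k j) / INR (binom (2 * j) j).
Proof.
repeat apply Rmult_le_pos; try apply pos_INR; [apply pow_le; lra|].
left. apply Rinv_0_lt_compat, binom_central_pos.
Qed.

Lemma RHS_ge_1 (k d : nat) : 1 <= RHS k d.
Proof.
unfold RHS. rewrite sumR_split_first.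
assert (0 <= sumR k (fun i => 8 ^ S i * INR (binom (d - 1) (S i)) * INR (binom k (S i))
  / INR (binom (2 * S i) (S i)))) by (apply sumR_pos; intros; apply RHS_term_pos).
rewrite !binom_0_r. simpl (INR 1). simpl (8 ^ 0). lra.
Qed.

Lemma wave_derivative_at_0 (k n : nat) : Rabs (wave n k 0) = RHS k (S n).
Proof.
assert (E : wave n k 0 = (-1) ^ k * RHS k (S n)).
{ transitivity (expoly_jet (S n) (fun i => 1 ^ i * scaled_laguerre 2 n i) k 0).
  - unfold wave. rewrite !expoly_jet_at_0.
    + apply sumR_ext. intros. rewrite pow1. ring.
    + intros j Hj. unfold scaled_laguerre. rewrite laguerre_vanish by lia. ring.
    + intros j Hj. unfold scaled_laguerre. rewrite laguerre_vanish by lia. ring.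
  - rewrite scaled_wave_derivative_at_0. f_equal. apply sumR_ext. intros.
    rewrite pow1. ring. }
rewrite E, Rabs_mult, pow_1_abs, Rabs_right; [ring|]. pose proof (RHS_ge_1 k (S n)). lra.
Qed.

(** What S_d and the negated [wave] have in common; the inequality accommodates peaks of modulus
    greater than 1. *)
Definition alternating (d : nat) (Q : nat -> R -> R) : Prop :=
  jet Q /\ ker (repeat 1 d) Q /\ exists nu, nu 0%nat = 0 /\ incr d nu /\
    forall i, (i < d)%nat -> 1 <= - (-1) ^ i * Q 0%nat (nu i).

Lemma in_Delta_evec (d : nat) : in_Delta d evec.
Proof. unfold in_Delta, evec. repeat split; intros; lra. Qed.

Lemma in_Delta_range (d : nat) (h : nat -> R) (a : R) :
  in_Delta d h -> In a (map h (seq 0 d)) -> 0 < a <= 1.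
Proof.
intros (H0 & Hm & H1) Ha. apply in_map_iff in Ha. destruct Ha as (i & <- & Hi).
apply in_seq in Hi. split; [|apply H1; lia].
assert (G : forall j, (j < d)%nat -> 0 < h j).
{ induction j as [|j IH]; intros Hj; [exact H0|].
  apply Rlt_le_trans with (h j); [apply IH; lia|apply Hm; lia]. }
apply G. lia.
Qed.

(** Translation by t moves the derivative to 0 and keeps the shifted nodes in the half-line, where
    |p| <= 1. *)
Lemma derivative_bound (d k : nat) (Q : nat -> R -> R) (h : nat -> R) (p g : R -> R) (t : R) :
  alternating d Q -> in_Delta d h -> in_P d h p -> supnorm_le1 p ->
  nth_deriv (S k) p g -> 0 <= t -> Rabs (g t) <= Rabs (Q (S k) 0).
Proof.
intros (JQ & KQ & nu & H0 & Hnu & Hal) Hh Hp Hn Hg Ht.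
destruct (in_P_jet d h p Hp) as (F & JF & KF & EF).
rewrite (nth_deriv_jet (S k) F p g JF EF Hg).
replace (F (S k) t) with (F (S k) (0 + t)) by (f_equal; ring).
assert (Ll : (length (map h (seq 0 d)) + 0)%nat = d)
  by (rewrite length_map, length_seq; lia).
assert (Nn : forall i, (i < d)%nat -> 0 <= nu i).
{ intros [|i] Hi; [lra|]. left. rewrite <- H0. apply (incr_lt d); [exact Hnu|lia|exact Hi]. }
apply (comparison (map h (seq 0 d)) 0 k nu (fun n x => F n (x + t)) Q); rewrite ?Ll;
  try assumption.
- intros a Ha. now apply (in_Delta_range d h).
- now apply jet_translate.
- simpl. rewrite app_nil_r. now apply ker_translate.
- intros i Hi. rewrite <- EF. apply Hn. specialize (Nn i Hi). lra.
Qed.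

Lemma cheb_alternating (d : nat) (T : R -> R) :
  is_cheb d evec T ->
  exists F, alternating d F /\ (forall t, T t = F 0%nat t) /\ supnorm_le1 T.
Proof.
intros (HP & [Hub _] & nu & H1 & Hnu & HT).
destruct (in_P_jet d evec T HP) as (F & JF & KF & EF).
exists F. split; [|split; [exact EF|]].
- split; [exact JF|]. rewrite map_evec in KF. split; [exact KF|].
  exists (fun i => nu (S i)). split; [exact H1|]. split.
  + intros i Hi. apply Hnu; lia.
  + intros i Hi. rewrite <- EF, HT by lia. pose proof (pow_m1_sqr i). simpl pow. lra.
- intros t Ht. apply Hub. exists t. now split.
Qed.

(** With Q = T in [derivative_bound], |g(0)| bounds all three sets; as T is admissible, it also
    belongs to each of them. *)
Lemma cheb_lub (d k : nat) (T g : R -> R) :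
  is_cheb d evec T -> nth_deriv (S k) T g ->
  is_lub (LHS_set (S k) d) (Rabs (g 0)) /\ is_lub (M_set (S k) d) (Rabs (g 0)) /\
  is_lub (abs_vals g) (Rabs (g 0)).
Proof.
intros HT Hg. destruct (cheb_alternating d T HT) as (F & HF & EF & Hn).
assert (Eg : Rabs (g 0) = Rabs (F (S k) 0))
  by (f_equal; apply (nth_deriv_jet (S k) F T g); [apply HF|exact EF|exact Hg]).
assert (UB : is_upper_bound (LHS_set (S k) d) (Rabs (g 0))).
{ intros x (h & p & q & Hh & Hp & Hpn & Hq & t & Ht & ->). rewrite Eg.
  now apply (derivative_bound d k F h p q). }
assert (InM : forall p q t, in_P d evec p -> supnorm_le1 p -> nth_deriv (S k) p q -> 0 <= t ->
  LHS_set (S k) d (Rabs (q t))).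
{ intros p q t Hp Hpn Hq Ht. exists evec, p, q. split; [apply in_Delta_evec|].
  repeat (split; [assumption|]). now exists t. }
assert (A0 : abs_vals g (Rabs (g 0))) by (exists 0; split; [lra|reflexivity]).
repeat split.
- exact UB.
- intros b Hb. apply Hb. apply (InM T g 0); [apply HT|exact Hn|exact Hg|lra].
- intros x (p & q & Hp & Hpn & Hq & t & Ht & ->). apply UB. now apply (InM p q t).
- intros b Hb. apply Hb. exists T, g. split; [apply HT|]. repeat (split; [assumption|]). exact A0.
- intros x (t & Ht & ->). apply UB. apply (InM T g t); [apply HT|exact Hn|exact Hg|exact Ht].
- intros b Hb. now apply Hb.
Qed.

Lemma is_cheb_exists (d : nat) : exists c, is_cheb (S d) evec (expoly (S d) c).
Proof.
destruct (chebyshev_exists d) as (c & nu & H0 & Hnu & Hv & Hb).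
exists c. split; [|split].
- apply in_P_evec. now exists c.
- split.
  + intros x (t & Ht & ->). now apply Hb.
  + intros b Hb'. apply Hb'. exists 0. split; [lra|].
    rewrite <- H0, Hv by lia. rewrite Rabs_Ropp, pow_1_abs. reflexivity.
(* [pred] passes to the numbering of nodes from 1, and absorbs the minus sign in - (-1)^i. *)
- exists (fun i => nu (pred i)). split; [exact H0|]. split.
  + intros [|j] Hj Hjd; [lia|]. apply Hnu. simpl. lia.
  + intros [|j] Hj Hjd; [lia|]. simpl pred. rewrite Hv by lia. simpl. ring.
Qed.

Lemma LHS_le_RHS (d k : nat) (x : R) : LHS_set (S k) (S d) x -> x <= RHS (S k) (S d).
Proof.
intros (h & p & g & Hh & Hp & Hn & Hg & t & Ht & ->).
rewrite <- wave_derivative_at_0.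
assert (A : alternating (S d) (fun n t => (-1) * wave d n t + 0 * wave d n t)).
{ split; [apply jet_lin; apply jet_wave|].
  split; [apply ker_lin; apply ker_expoly|].
  destruct (wave_peaks d) as (y & Hy0 & Hy & Hv). exists y.
  split; [exact Hy0|]. split; [exact Hy|].
  intros i Hi. specialize (Hv i ltac:(lia)). lra. }
pose proof (derivative_bound (S d) k _ h p g t A Hh Hp Hn Hg Ht) as B. cbv beta in B.
replace (-1 * wave d (S k) 0 + 0 * wave d (S k) 0) with (- wave d (S k) 0) in B by ring.
now rewrite Rabs_Ropp in B.
Qed.

Lemma bernoulli_sub (x : R) (k : nat) : 0 <= x <= 1 -> 1 - INR k * x <= (1 - x) ^ k.
Proof.
intros Hx. induction k as [|k IH]; [simpl; lra|].
rewrite S_INR. simpl pow.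
apply Rle_trans with ((1 - x) * (1 - INR k * x)).
- pose proof (pos_INR k). assert (0 <= INR k * (x * x)); [|lra].
  apply Rmult_le_pos; nra.
- apply Rmult_le_compat_l; lra.
Qed.

(* Test function: [wave] in the variable [lam t], with [e^{-(1 - lam) t}] damping its last
   oscillations, which exceed 1. *)
Lemma LHS_lower (lam : R) (k : nat) :
  0 < lam < 1 -> exists n0, forall n, (n0 <= n)%nat ->
  exists x, LHS_set (S k) (S n) x /\ lam ^ S k * RHS (S k) (S n) <= x.
Proof.
intros Hl. set (delta := (1 - lam) / lam).
assert (Hd : 0 < delta) by (apply Rdiv_lt_0_compat; lra).
(* N >= M gives both conditions of [wave_damped]; the summand 1 serves N^2 >= N. *)
set (M := / delta + 8 / delta ^ 4 + 1).
assert (D4 : 0 < delta ^ 4) by (apply pow_lt; lra).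
assert (I1 : 0 < / delta) by (apply Rinv_0_lt_compat; lra).
assert (I2 : 0 < 8 / delta ^ 4) by (apply Rdiv_lt_0_compat; lra).
destruct (INR_unbounded M) as [n0 Hn0].
exists n0. intros n Hn. apply le_INR in Hn.
assert (HN : M <= turning n) by (unfold turning; pose proof (pos_INR n); lra).
set (c := fun i => lam ^ i * scaled_laguerre 2 n i).
exists (Rabs (expoly_jet (S n) c (S k) 0)). split.
- exists evec, (expoly (S n) c), (expoly_jet (S n) c (S k)).
  split; [apply in_Delta_evec|]. split; [apply in_P_evec; now exists c|]. split; [|split].
  + intros t Ht. unfold c. rewrite expoly_scaled.
    replace (exp (lam * t - t)) with (exp (- delta * (lam * t)))
      by (f_equal; unfold delta; field; lra).
    apply (wave_damped n delta (lam * t) Hd).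
    * unfold M in HN. lra.
    * apply Rle_trans with (delta ^ 4 * (8 / delta ^ 4)); [right; field; lra|].
      apply Rmult_le_compat_l; [lra|]. unfold M in HN.
      apply Rle_trans with (turning n); [lra|]. rewrite <- Rsqr_pow2. unfold Rsqr. nra.
    * apply Rmult_le_pos; lra.
  + apply (jet_nth_deriv (S k) (expoly_jet (S n) c)), jet_expoly.
  + exists 0. split; [lra|reflexivity].
- unfold c. rewrite scaled_wave_derivative_at_0, Rabs_mult, pow_1_abs, Rmult_1_l.
  (* The j-th term carries lam^j, which is at least lam^(S k) since j <= S k. *)
  eapply Rle_trans; [|apply Rle_abs]. unfold RHS. rewrite <- sumR_scal.
  apply sumR_le. intros j Hj. apply Rmult_le_compat_r; [apply RHS_term_pos|].
  replace (S k) with (j + (S k - j))%nat by lia. rewrite pow_add.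
  assert (0 <= lam ^ j) by (apply pow_le; lra).
  assert (lam ^ (S k - j) <= 1).
  { rewrite <- (pow1 (S k - j)). apply pow_incr. lra. }
  nra.
Qed.

Theorem theorem2 :
  forall k : nat, (1 <= k)%nat ->
  exists L : nat -> R,
    (forall d : nat, (1 <= d)%nat ->
       (* L d is the max of ||p^(k)|| over h in Delta_d, p in P_h, ||p|| <= 1 *)
       is_lub (LHS_set k d) (L d) /\
       (* it equals M_{k,d} *)
       is_lub (M_set k d) (L d) /\
       (* the upper bound *)
       L d <= RHS k d /\
       (* S_d exists and the maximum is attained at p = S_d *)
       (exists T, is_cheb d evec T) /\
       (forall T g, is_cheb d evec T -> nth_deriv k T g ->
          is_lub (abs_vals g) (L d))) /\
    (* asymptotic tightness for fixed k as d -> infinity *)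
    Un_cv (fun d => L d / RHS k d) 1.
Proof.
intros [|k] Hk; [lia|clear Hk].
assert (Ex : forall d, exists l, (1 <= d)%nat ->
  exists T g, is_cheb d evec T /\ nth_deriv (S k) T g /\ l = Rabs (g 0)).
(* The value at d = 0 is a dummy. *)
{ intros [|d]; [exists 0; lia|]. destruct (is_cheb_exists d) as [c Hc].
  exists (Rabs (expoly_jet (S d) c (S k) 0)). intros _.
  exists (expoly (S d) c), (expoly_jet (S d) c (S k)). split; [exact Hc|]. split; [|reflexivity].
  apply (jet_nth_deriv (S k) (expoly_jet (S d) c)), jet_expoly. }
destruct (functional_choice _ Ex) as [L HL]. exists L.
assert (Main : forall d, (1 <= d)%nat -> is_lub (LHS_set (S k) d) (L d) /\
  is_lub (M_set (S k) d) (L d) /\ L d <= RHS (S k) d).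
{ intros d Hd. destruct (HL d Hd) as (T & g & HT & Hg & ->).
  destruct (cheb_lub d k T g HT Hg) as (H1 & H2 & _).
  split; [exact H1|]. split; [exact H2|].
  destruct d as [|d]; [lia|]. apply H1. intros x. apply LHS_le_RHS. }
split.
- intros d Hd. destruct (Main d Hd) as (H1 & H2 & H3).
  split; [exact H1|]. split; [exact H2|]. split; [exact H3|]. split.
  + destruct (HL d Hd) as (T & g & HT & _). now exists T.
  + intros T g HT Hg. destruct (cheb_lub d k T g HT Hg) as (H1' & _ & H).
    now rewrite (is_lub_u _ _ _ H1 H1').
- intros eps Heps.
  (* With lam = 1 - e, Bernoulli's inequality gives lam^(S k) >= 1 - eps / 2; the minimum with 1
     keeps lam positive. *)
  set (e := Rmin eps 1 / (2 * INR (S k))).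
  assert (Pk : 1 <= INR (S k)) by (change 1 with (INR 1); apply le_INR; lia).
  pose proof (Rmin_l eps 1). pose proof (Rmin_r eps 1).
  assert (Pm : 0 < Rmin eps 1) by (apply Rmin_glb_lt; lra).
  assert (Ee : INR (S k) * e = Rmin eps 1 / 2) by (unfold e; field; lra).
  assert (He : 0 < e) by (apply Rdiv_lt_0_compat; lra).
  assert (He1 : e < 1) by nra.
  destruct (LHS_lower (1 - e) k) as [n0 Hn0]; [lra|].
  exists (S n0). intros [|n] Hn; [lia|].
  destruct (Hn0 n) as (x & Hx & Hlx); [lia|].
  destruct (Main (S n)) as (H1 & _ & H3); [lia|].
  apply H1 in Hx. pose proof (RHS_ge_1 (S k) (S n)) as HR.
  pose proof (bernoulli_sub e (S k) ltac:(lra)) as Hb. rewrite Ee in Hb.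
  set (r := RHS (S k) (S n)) in *.
  assert (Lo : 1 - eps / 2 <= L (S n) / r).
  { apply Rmult_le_reg_r with r; [lra|]. unfold Rdiv at 2.
    rewrite Rmult_assoc, Rinv_l, Rmult_1_r by lra.
    apply Rle_trans with ((1 - e) ^ S k * r); [|lra].
    apply Rmult_le_compat_r; lra. }
  assert (Hi : L (S n) / r <= 1).
  { apply Rmult_le_reg_r with r; [lra|]. unfold Rdiv.
    rewrite Rmult_assoc, Rinv_l, Rmult_1_r by lra. lra. }
  unfold Rdist. apply Rabs_def1; lra.
Qed.
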